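(* Let $(a_n)_{n=0}^{\infty}$ be a greedy $s$-energy sequence on $S^1$ with $s=1$. Then the sequence $$\left(\frac{U_{N,1}(a_N)-\frac{1}{\pi}N\log N}{N}\right)_{N=1}^{\infty}$$ is bounded and divergent. Moreover, we have $$\limsup_{N\to\infty}\frac{U_{N,1}(a_N)-\frac{1}{\pi}N\log N}{N}=\frac{1}{\pi}\left(\gamma+\log\left(\frac{8}{\pi}\right)\right),$$ $$\liminf_{N\to\infty}\frac{U_{N,1}(a_N)-\frac{1}{\pi}N\log N}{N}=\frac{1}{\pi}\left(\gamma+\log\left(\frac{8}{\pi}\right)+\lambda\right),$$ where $\gamma=\lim_{N\to\infty}\left(\sum_{k=1}^N\frac{1}{k}-\log N\right)$ is the Euler-Mascheroni constant and $\lambda=\inf_{\vec{\theta}\in\Theta}\Lambda(\vec{\theta})$. For each $\vec{\theta}\in\Theta$, the quantity $\frac{1}{\pi}\left(\gamma+\log\left(\frac{8}{\pi}\right)+\Lambda(\vec{\theta})\right)$ is a limit point of the sequence $\left(\frac{U_{N,1}(a_N)-\frac{1}{\pi}N\log N}{N}\right)_{N=1}^{\infty}$.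
   Context: $S^1=\{z\in\mathbb{C}:|z|=1\}$. A sequence $(a_n)_{n=0}^{\infty}\subset S^1$ is a greedy $s$-energy sequence on $S^1$ with $s=1$ if for every $n\geq 1$, $\sum_{k=0}^{n-1}|a_n-a_k|^{-1}=\inf_{z\in S^1}\sum_{k=0}^{n-1}|z-a_k|^{-1}$ (with $|z-a_k|^{-1}=+\infty$ when $z=a_k$). For $N\geq 1$, $U_{N,1}(z):=\sum_{k=0}^{N-1}|z-a_k|^{-1}$. For an integer $N\geq 1$ let $\tau_b(N)$ be the number of $1$'s in the binary representation of $N$. For an integer $p\geq 1$, $\Theta_p$ is the set of all $\vec{\theta}=(\theta_1,\ldots,\theta_p)\in\mathbb{R}^p$ for which there is an infinite sequence $\mathcal{N}$ of positive integers such that every $N\in\mathcal{N}$ satisfies $\tau_b(N)=p$ and, writing $N=2^{n_1}+\cdots+2^{n_p}$ with $n_1>\cdots>n_p\geq 0$ (the $n_k$ depending on $N$), $\lim_{N\in\mathcal{N}}2^{n_k}/N=\theta_k$ for all $1\leq k\leq p$. Set $\Theta=\bigcup_{p\geq 1}\Theta_p$, and for $\vec{\theta}=(\theta_1,\ldots,\theta_p)\in\Theta$ set $\Lambda(\vec{\theta})=\sum_{k=1}^p\theta_k\log\theta_k$, where $\theta_k\log\theta_k=0$ if $\theta_k=0$. ''Divergent'' means not convergent; a limit point of a sequence is the limit of some convergent subsequence. *)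

(* Defs.v *)
From Stdlib Require Import Reals Lra Lia List Sorted.
From Coquelicot Require Import Coquelicot.
Import ListNotations.
Open Scope R_scope.

(* [|z - w|^{-1}], with value [+oo] when [z = w] (the real inverse of Rocq
   satisfies [/ 0 = 0], hence the case distinction). *)
Definition inv_dist (z w : C) : Rbar :=
  if Ceq_dec z w then p_infty else Finite (/ Cmod (z - w)).

(* [U a N z] is the sum of [|z - a_k|^{-1}] over [0 <= k < N]. *)
Fixpoint U (a : nat -> C) (N : nat) (z : C) : Rbar :=
  match N with
  | O => Finite 0
  | S n => Rbar_plus (U a n z) (inv_dist z (a n))
  end.

Definition greedy (a : nat -> C) : Prop :=
  (forall n, Cmod (a n) = 1) /\
  (forall n, (1 <= n)%nat ->
     Rbar_is_glb (fun y => exists z : C, Cmod z = 1 /\ y = U a n z)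
                 (U a n (a n))).

(* The sequence is indexed from [N = 1]: its term of index [n] is that of
   [N = n + 1].  Taking [real] is harmless, by [greedy_U_finite] below. *)
Definition normalized_U (a : nat -> C) (n : nat) : R :=
  let N := S n in
  (real (U a N (a N)) - 1 / PI * INR N * ln (INR N)) / INR N.

Definition limit_point (u : nat -> R) (l : R) : Prop :=
  exists phi : nat -> nat,
    (forall i, (phi i < phi (S i))%nat) /\ is_lim_seq (fun i => u (phi i)) l.

(* [sum_n_m f 1 N] is the sum of [f k] over [1 <= k <= N]. *)
Definition euler_gamma : R :=
  real (Lim_seq (fun N => sum_n_m (fun k => / INR k) 1 N - ln (INR N))).

(* The bits of [N] at positions [>= N] all vanish. *)
Definition tau_b (N : nat) : nat :=
  length (filter (Nat.testbit N) (seq 0 N)).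

(* [N = 2^{n_1} + ... + 2^{n_p}] with [e = [n_1; ...; n_p]] decreasing. *)
Definition binary_exponents (N : nat) (e : list nat) : Prop :=
  StronglySorted gt e /\ N = list_sum (map (Nat.pow 2) e).

(* The tuple [(theta_1, ..., theta_p)] is a list of length [p], and the
   infinite sequence of integers is enumerated increasingly by [N], with
   exponents [e j] for [N j]. *)
Definition Theta_ (p : nat) (theta : list R) : Prop :=
  length theta = p /\
  exists (N : nat -> nat) (e : nat -> list nat),
    (forall j, (N j < N (S j))%nat) /\
    (forall j, (1 <= N j)%nat /\ tau_b (N j) = p /\
               length (e j) = p /\ binary_exponents (N j) (e j)) /\
    (forall k, (k < p)%nat ->
       is_lim_seq (fun j => 2 ^ nth k (e j) 0%nat / INR (N j))
                  (nth k theta 0)).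

Definition Theta (theta : list R) : Prop :=
  exists p, (1 <= p)%nat /\ Theta_ p theta.

(* [0 * ln 0 = 0], as [ln] is total. *)
Definition Lambda (theta : list R) : R :=
  fold_right Rplus 0 (map (fun t => t * ln t) theta).

Definition lambda : R :=
  real (Glb_Rbar (fun x => exists theta, Theta theta /\ x = Lambda theta)).

(* The total operators [real], [Lim_seq] and [Glb_Rbar] above never return a
   default value. *)

Lemma U_finite (a : nat -> C) (n : nat) (z : C) :
  (forall k, (k < n)%nat -> z <> a k) -> is_finite (U a n z).
Proof.
induction n as [|n IH]; intros H; simpl.
- reflexivity.
- rewrite <- IH by (intros; apply H; lia).
  unfold inv_dist; destruct (Ceq_dec z (a n)) as [e|_].
  + exfalso; apply (H n); [lia|exact e].
  + reflexivity.
Qed.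

Lemma avoid_finite (f : nat -> R) (n : nat) :
  exists c d, 0 < c < d /\ d < 1 /\
    forall x k, (k < n)%nat -> c < x < d -> x <> f k.
Proof.
induction n as [|n [c [d [Hcd [Hd H]]]]].
- exists (1/3), (2/3); repeat split; try lra; intros; lia.
- destruct (Rle_dec (f n) ((c + d) / 2)) as [Hf|Hf].
  + exists ((c + d) / 2), d; repeat split; try lra.
    intros x k Hk Hx; destruct (Nat.eq_dec k n) as [->|Hn]; [lra|].
    apply H; [lia|lra].
  + exists c, ((c + d) / 2); repeat split; try lra.
    intros x k Hk Hx; destruct (Nat.eq_dec k n) as [->|Hn]; [lra|].
    apply H; [lia|lra].
Qed.

Lemma U_ge0 (a : nat -> C) (n : nat) (z : C) : Rbar_le 0 (U a n z).
Proof.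
induction n as [|n IH]; simpl; [lra|].
unfold inv_dist; destruct (Ceq_dec z (a n)) as [e|e].
- destruct (U a n z); simpl in *; try easy.
- assert (0 < / Cmod (z - a n)).
  { apply Rinv_0_lt_compat, Cmod_gt_0; intros h; apply e.
    replace z with ((z - a n) + a n)%C by ring; rewrite h; ring. }
  destruct (U a n z); simpl in *; try easy; lra.
Qed.

Lemma greedy_U_finite (a : nat -> C) (n : nat) :
  greedy a -> is_finite (U a n (a n)).
Proof.
intros [_ Ha]; destruct n as [|n]; [reflexivity|].
destruct (avoid_finite (fun k => Re (a k)) (S n)) as [c [d [Hc [Hd H]]]].
set (x := (c + d) / 2).
assert (Hx : 0 <= 1 - x * x) by (unfold x; nra).
destruct (Ha (S n) ltac:(lia)) as [Hlb _].
assert (Hle : Rbar_le (U a (S n) (a (S n))) (U a (S n) (x, sqrt (1 - x * x)))).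
{ apply Hlb; eexists; split; [|reflexivity].
  unfold Cmod; simpl; rewrite !Rmult_1_r, sqrt_sqrt by exact Hx.
  replace (x * x + (1 - x * x)) with 1 by ring; apply sqrt_1. }
rewrite <- (U_finite a (S n) (x, sqrt (1 - x * x))) in Hle.
- generalize (U_ge0 a (S n) (a (S n))).
  destruct (U a (S n) (a (S n))); easy.
- intros k Hk E; apply (H x k Hk); [unfold x; lra|].
  rewrite <- E; reflexivity.
Qed.

Lemma ln_le_sub1 (x : R) : 0 < x -> ln x <= x - 1.
Proof.
intros Hx; rewrite <- (ln_exp (x - 1)); apply ln_le; [exact Hx|].
generalize (exp_ineq1_le (x - 1)); lra.
Qed.

Lemma euler_gamma_lim :
  is_lim_seq (fun N => sum_n_m (fun k => / INR k) 1 N - ln (INR N)) euler_gamma.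
Proof.
set (u := fun N => sum_n_m (fun k => / INR k) 1 N - ln (INR N)).
unfold euler_gamma; fold u.
assert (Hpos : forall n, 0 < INR (S n)) by (intros; apply lt_0_INR; lia).
assert (Hstep : forall n, sum_n_m (fun k => / INR k) 1 (S n)
                 = sum_n_m (fun k => / INR k) 1 n + / INR (S n)).
{ intros n; exact (sum_n_Sm (fun k => / INR k) 1 n ltac:(lia)). }
apply Lim_seq_correct'.
destruct (ex_finite_lim_seq_decr (fun n => u (n + 1)%nat) 0) as [l Hl];
  [ | | exists l; apply (is_lim_seq_incr_n u 1 l); exact Hl ].
- intros n; unfold u; rewrite !Nat.add_1_r, (Hstep (S n)).
  assert (H := ln_le_sub1 (INR (S n) / INR (S (S n)))
                 ltac:(apply Rdiv_lt_0_compat; apply Hpos)).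
  rewrite ln_div in H by apply Hpos.
  assert (E : INR (S n) / INR (S (S n)) - 1 = - / INR (S (S n))).
  { rewrite (S_INR (S n)); field; rewrite <- S_INR; apply Rgt_not_eq, Hpos. }
  lra.
- assert (G : forall n, ln (INR (S n)) <= sum_n_m (fun k => / INR k) 1 n).
  { induction n as [|n IH].
    - simpl; rewrite ln_1, sum_n_m_zero by lia; apply Rle_refl.
    - rewrite Hstep.
      assert (H := ln_le_sub1 (INR (S (S n)) / INR (S n))
                     ltac:(apply Rdiv_lt_0_compat; apply Hpos)).
      rewrite ln_div in H by apply Hpos.
      assert (E : INR (S (S n)) / INR (S n) - 1 = / INR (S n)).
      { rewrite (S_INR (S n)); field; apply Rgt_not_eq, Hpos. }
      lra. }
  intros n; unfold u; rewrite Nat.add_1_r, Hstep.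
  generalize (G n) (Rinv_0_lt_compat _ (Hpos n)); lra.
Qed.

Lemma xlnx_ge (t q : R) : 0 <= t -> 0 < q -> t * ln q + t - q <= t * ln t.
Proof.
intros [Ht|<-] Hq; [|lra].
assert (H := ln_le_sub1 (q / t) ltac:(apply Rdiv_lt_0_compat; lra)).
rewrite ln_div in H by lra.
apply (Rmult_le_compat_l t) in H; [|lra].
replace (t * (q / t - 1)) with (q - t) in H by (field; lra); lra.
Qed.

Lemma Lambda_ge (theta : list R) (k : nat) :
  (forall i, (i < length theta)%nat -> 0 <= nth i theta 0 <= / 2 ^ (k + i)) ->
  - ((2 * INR k + 4) / 2 ^ k) <= Lambda theta.
Proof.
revert k; induction theta as [|t l IH]; intros k H; unfold Lambda; simpl;
  assert (Hk : 0 < 2 ^ k) by (apply pow_lt; lra);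
  assert (Ik : 0 <= INR k) by apply pos_INR.
- assert (0 <= (2 * INR k + 4) / 2 ^ k) by (apply Rdiv_le_0_compat; lra); lra.
- assert (H0 := H 0%nat ltac:(simpl; lia)); simpl in H0; rewrite Nat.add_0_r in H0.
  assert (H1 : - ((2 * INR (S k) + 4) / 2 ^ S k) <= Lambda l).
  { apply IH; intros i Hi; replace (S k + i)%nat with (k + S i)%nat by lia.
    exact (H (S i) ltac:(simpl; lia)). }
  unfold Lambda in H1.
  assert (H2 := xlnx_ge t (/ 2 ^ k) (proj1 H0) ltac:(apply Rinv_0_lt_compat; lra)).
  rewrite ln_Rinv, Rpower.ln_pow in H2 by lra.
  assert (L2 : 0 <= ln 2 <= 1).
  { generalize ln_lt_2 (ln_le_sub1 2); lra. }
  assert (H3 : t * (INR k * ln 2) <= / 2 ^ k * INR k).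
  { apply Rmult_le_compat; [lra|nra|lra|nra]. }
  assert (E : (2 * INR k + 4) / 2 ^ k
            = (2 * INR (S k) + 4) / 2 ^ S k + (/ 2 ^ k * INR k + / 2 ^ k)).
  { rewrite S_INR; simpl; field; lra. }
  lra.
Qed.

Lemma sorted_gt_nth (e : list nat) (k : nat) :
  StronglySorted gt e -> (k < length e)%nat ->
  (nth k e 0 + k <= nth 0 e 0)%nat.
Proof.
intros H; revert k; induction H as [|x l Hl IH Hx]; intros k Hk; simpl in Hk; [lia|].
destruct k as [|k]; simpl; [lia|].
destruct l as [|y l]; simpl in Hk; [lia|].
specialize (IH k ltac:(simpl; lia)); inversion Hx; subst; simpl nth in *; lia.
Qed.

Lemma Theta_bounds (p : nat) (theta : list R) (k : nat) :
  Theta_ p theta -> (k < p)%nat -> 0 <= nth k theta 0 <= / 2 ^ k.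
Proof.
intros [_ [N [e [_ [He Hlim]]]]] Hk; specialize (Hlim k Hk).
assert (B : forall j, 0 <= 2 ^ nth k (e j) 0%nat / INR (N j) <= / 2 ^ k).
{ intros j; destruct (He j) as [HN [_ [Hlen [Hs HNe]]]].
  assert (PN : 0 < INR (N j)) by (apply lt_0_INR; lia).
  assert (P2 : 0 < 2 ^ k) by (apply pow_lt; lra).
  split; [apply Rdiv_le_0_compat; [apply pow_le; lra|exact PN]|].
  assert (Hn := sorted_gt_nth (e j) k Hs ltac:(lia)).
  assert (Hsum : (2 ^ nth 0 (e j) 0 <= N j)%nat).
  { rewrite HNe; destruct (e j) as [|x l]; [simpl in Hlen; lia|simpl; lia]. }
  assert (Hr : 2 ^ nth k (e j) 0%nat * 2 ^ k <= INR (N j)).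
  { rewrite <- pow_add; apply Rle_trans with (2 ^ nth 0 (e j) 0%nat).
    - apply Rle_pow; [lra|exact Hn].
    - apply le_INR in Hsum; rewrite pow_INR in Hsum; exact Hsum. }
  apply (Rmult_le_reg_r (INR (N j) * 2 ^ k)); [nra|].
  replace (2 ^ nth k (e j) 0%nat / INR (N j) * (INR (N j) * 2 ^ k))
    with (2 ^ nth k (e j) 0%nat * 2 ^ k) by (field; lra).
  replace (/ 2 ^ k * (INR (N j) * 2 ^ k)) with (INR (N j)) by (field; lra).
  exact Hr. }
split.
- exact (is_lim_seq_le (fun _ => 0) _ (Finite 0) (Finite (nth k theta 0))
           (fun j => proj1 (B j)) (is_lim_seq_const 0) Hlim).
- exact (is_lim_seq_le _ (fun _ => / 2 ^ k) (Finite (nth k theta 0)) (Finite (/ 2 ^ k))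
           (fun j => proj2 (B j)) Hlim (is_lim_seq_const _)).
Qed.

Lemma tau_b_pow2 (n : nat) : tau_b (2 ^ n) = 1%nat.
Proof.
assert (Hf : forall l, NoDup l ->
          (length (filter (Nat.testbit (2 ^ n)) l) = if in_dec Nat.eq_dec n l then 1 else 0)%nat).
{ intros l Hl; induction Hl as [|x l Hx Hl IH]; simpl; [reflexivity|].
  rewrite Nat.pow2_bits_eqb.
  destruct (Nat.eqb_spec n x) as [E|E]; destruct (Nat.eq_dec x n) as [E'|E'];
    try congruence; simpl; rewrite IH; destruct (in_dec Nat.eq_dec n l); congruence. }
unfold tau_b; rewrite Hf by apply seq_NoDup.
destruct (in_dec Nat.eq_dec n (seq 0 (2 ^ n))) as [_|H]; [reflexivity|].
exfalso; apply H, in_seq; split; [lia|].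
apply Nat.pow_gt_lin_r; lia.
Qed.

Lemma Theta_one : Theta [1].
Proof.
exists 1%nat; split; [lia|split; [reflexivity|]].
exists (fun j => (2 ^ j)%nat), (fun j => [j]); split; [|split].
- intros j; apply Nat.pow_lt_mono_r; lia.
- intros j; split; [|split; [apply tau_b_pow2|split; [reflexivity|split]]].
  + generalize (Nat.pow_nonzero 2 j); lia.
  + repeat constructor.
  + simpl; lia.
- intros k Hk; replace k with 0%nat by lia; simpl nth.
  apply is_lim_seq_ext with (fun _ => 1); [|apply is_lim_seq_const].
  intros j; rewrite pow_INR; simpl INR; replace (1 + 1) with 2 by ring.
  field; apply pow_nonzero; lra.
Qed.

Lemma lambda_glb :
  is_glb_Rbar (fun x => exists theta, Theta theta /\ x = Lambda theta) lambda.
Proof.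
unfold lambda; set (E := fun x => _).
generalize (Glb_Rbar_correct E); destruct (Glb_Rbar E) as [r| |]; intros [H1 H2].
- split; assumption.
- exfalso; apply (H1 (Lambda [1])); exists [1]; split; [apply Theta_one|reflexivity].
- exfalso; apply (H2 (Finite (- ((2 * INR 0 + 4) / 2 ^ 0)))).
  intros x [theta [[p [_ Hp]] ->]]; apply (Lambda_ge theta 0).
  intros i Hi; simpl Nat.add; apply (Theta_bounds p); [exact Hp|].
  destruct Hp as [<- _]; exact Hi.
Qed.

(* Main.v *)
Require Import Defs.
From Stdlib Require Import Reals List Lra Lia ZArith Permutation Sorted Classical.
From Coquelicot Require Import Coquelicot.
Import ListNotations.
Open Scope R_scope.

(** Write [m = 2^n].  The potential of the vertices of a regular [m]-gon is, by
    convexity of the cosecant, least exactly at the midpoints of its [m] arcs;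
    let [gon_min m] be that least value.  A greedy sequence therefore starts
    with regular polygons: once [a_0, ..., a_(m-1)] are the vertices of an
    [m]-gon, the next [m] points are the midpoints of its arcs.  The reason is
    that at step [m + k], [k < m], the potential is that of the [m]-gon plus
    that of the tail [a_m, ..., a_(m+k-1)].  The tail is itself greedy, so by
    induction on [n] its potential has a minimizer among the vertices of the
    [m]-gon through [a_m], which are midpoints.  Both summands are thus
    minimized at a common point, and the minimizers of the sum are exactly the
    common minimizers ([greedy_split]).  Peeling off one binary digit of [N]
    after the other gives, for [N = 2^n_1 + ... + 2^n_p],

      U_N(a_N) = gon_min (2^n_1) + ... + gon_min (2^n_p)   ([greedy_value]).

    Comparing [1 / sin] with [1 / x] splits [gon_min m] into a combination of
    harmonic numbers and a midpoint Riemann sum, whence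
    [gon_min m = (m / PI) (ln m + gamma + ln (8 / PI) + o(1))]
    ([gon_min_defect_lim]).  Substituting [m = 2^n_k] and writing
    [w_k = 2^n_k / N], which sum to [1], the normalized potential is

      (1 / PI) (gamma + ln (8 / PI) + Lambda (w_1, ..., w_p)) + o(1),

    because an average of a null sequence with these weights tends to [0] as [N] grows
    ([dyadic_average]).

    All limit points can be read off.  Continuity of [t ln t] yields the limit
    point attached to each [theta] in [Theta].  Conversely the weights of a
    single [N] already belong to [Theta], since those of [N], [2 N], [4 N], ...
    agree; hence [lambda <= Lambda (w_1, ..., w_p)] for every [N], although the
    number of digits of [N] is unbounded.  Also [Lambda <= 0] on weights, with
    equality at the powers of two, while the weights [(2/3, 1/3)] of [N = 3]
    give a strictly smaller limit point, so the sequence diverges. *)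

(** * Sums over lists *)

Definition lsum {A : Type} (f : A -> R) (l : list A) : R :=
  fold_right Rplus 0 (map f l).

Lemma lsum_app {A} (f : A -> R) l1 l2 :
  lsum f (l1 ++ l2) = lsum f l1 + lsum f l2.
Proof.
unfold lsum; induction l1 as [|x l IH]; simpl; [ring|rewrite IH; ring].
Qed.

Lemma lsum_map {A B} (f : B -> R) (g : A -> B) l :
  lsum f (map g l) = lsum (fun x => f (g x)) l.
Proof. unfold lsum; now rewrite map_map. Qed.

Lemma lsum_ext {A} (f g : A -> R) l :
  (forall x, In x l -> f x = g x) -> lsum f l = lsum g l.
Proof. intros H; unfold lsum; now rewrite (map_ext_in f g l H). Qed.

Lemma lsum_plus {A} (f g : A -> R) l :
  lsum (fun x => f x + g x) l = lsum f l + lsum g l.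
Proof.
unfold lsum; induction l as [|x l IH]; simpl; [ring|rewrite IH; ring].
Qed.

Lemma lsum_scal {A} (c : R) (f : A -> R) l :
  lsum (fun x => c * f x) l = c * lsum f l.
Proof.
unfold lsum; induction l as [|x l IH]; simpl; [ring|rewrite IH; ring].
Qed.

Lemma lsum_le {A} (f g : A -> R) l :
  (forall x, In x l -> f x <= g x) -> lsum f l <= lsum g l.
Proof.
unfold lsum; induction l as [|x l IH]; simpl; intros H; [lra|].
apply Rplus_le_compat; auto.
Qed.

Lemma lsum_lt {A} (f g : A -> R) l :
  l <> [] -> (forall x, In x l -> f x < g x) -> lsum f l < lsum g l.
Proof.
destruct l as [|x l]; [easy|]; intros _ H.
apply Rplus_lt_le_compat; [apply H; now left|].
apply (lsum_le f g l); intros y Hy; apply Rlt_le, H; now right.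
Qed.

Lemma lsum_perm {A} (f : A -> R) l1 l2 :
  Permutation l1 l2 -> lsum f l1 = lsum f l2.
Proof.
unfold lsum; induction 1; simpl; try lra.
Qed.

Lemma lsum_seq_S (f : nat -> R) n :
  lsum f (seq 0 (S n)) = lsum f (seq 0 n) + f n.
Proof. rewrite seq_S, lsum_app; unfold lsum at 2; simpl; ring. Qed.

Lemma lsum_seq_add (f : nat -> R) m k :
  lsum f (seq 0 (m + k)) = lsum f (seq 0 m) + lsum (fun j => f (m + j)%nat) (seq 0 k).
Proof.
induction k as [|k IH]; [rewrite Nat.add_0_r; unfold lsum at 3; simpl; ring|].
rewrite Nat.add_succ_r, !lsum_seq_S, IH; ring.
Qed.

Lemma lsum_seq_rev (f : nat -> R) m :
  lsum f (seq 0 m) = lsum (fun j => f (m - 1 - j)%nat) (seq 0 m).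
Proof.
induction m as [|m IH]; [reflexivity|].
rewrite lsum_seq_S, IH.
rewrite (lsum_seq_add (fun j => f (S m - 1 - j)%nat) 1 m : lsum _ (seq 0 (S m)) = _).
replace (lsum (fun j => f (S m - 1 - j)%nat) (seq 0 1)) with (f m)
  by (unfold lsum; simpl; rewrite !Nat.sub_0_r; ring).
rewrite Rplus_comm; f_equal.
apply lsum_ext; intros j Hj; f_equal; lia.
Qed.

(** * The unit circle *)

Definition cis (x : R) : C := (cos x, sin x).

Lemma cis_plus x y : (cis x * cis y)%C = cis (x + y).
Proof.
unfold cis, Cmult; simpl; rewrite cos_plus, sin_plus; f_equal; ring.
Qed.

Lemma Cmod_cis x : Cmod (cis x) = 1.
Proof.
unfold Cmod, cis; simpl; rewrite !Rmult_1_r.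
replace (cos x * cos x + sin x * sin x) with 1; [apply sqrt_1|].
generalize (sin2_cos2 x); unfold Rsqr; lra.
Qed.

Lemma cis_2PI (k : Z) : cis (2 * PI * IZR k) = 1%C.
Proof.
unfold cis; replace (2 * PI * IZR k) with (2 * (IZR k * PI)) by ring.
rewrite cos_2a_sin, sin_2a.
rewrite (sin_eq_0_1 (IZR k * PI)) by now exists k.
unfold RtoC; f_equal; ring.
Qed.

Lemma Cmod_cis_minus x y : Cmod (cis x - cis y) = 2 * Rabs (sin ((x - y) / 2)).
Proof.
unfold Cmod, cis; simpl; rewrite !Rmult_1_r.
rewrite <- (sqrt_Rsqr (2 * Rabs (sin ((x - y) / 2)))) by (generalize (Rabs_pos (sin ((x-y)/2))); lra).
f_equal; rewrite Rsqr_mult, <- Rsqr_abs; unfold Rsqr.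
assert (E : cos (x - y) = 1 - 2 * sin ((x - y) / 2) * sin ((x - y) / 2)).
{ rewrite <- cos_2a_sin; f_equal; field. }
rewrite cos_minus in E.
generalize (sin2_cos2 x) (sin2_cos2 y); unfold Rsqr; lra.
Qed.

Lemma unit_cis (z : C) : Cmod z = 1 -> exists x, z = cis x.
Proof.
intros H.
assert (E : fst z * fst z + snd z * snd z = 1).
{ rewrite <- (sqrt_sqrt (fst z * fst z + snd z * snd z)) by nra.
  unfold Cmod in H; simpl in H; rewrite !Rmult_1_r in H; rewrite H; ring. }
assert (B : -1 <= fst z <= 1) by nra.
assert (Hs : sin (acos (fst z)) = Rabs (snd z)).
{ rewrite sin_acos by exact B; rewrite <- sqrt_Rsqr_abs; f_equal; unfold Rsqr; lra. }
destruct z as [u v]; simpl in *; unfold cis.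
destruct (Rle_dec 0 v) as [Hv|Hv].
- exists (acos u); rewrite cos_acos by exact B; rewrite Hs, Rabs_right by lra; reflexivity.
- exists (- acos u); rewrite cos_neg, sin_neg, cos_acos by exact B.
  rewrite Hs, Rabs_left by lra; f_equal; ring.
Qed.

(** The turn [2 PI k / m + t] is counted from [w]: the integer part of the
    angle between [w] and [z], in units of [2 PI / m], gives [k]. *)
Lemma unit_arc (w z : C) (m : nat) : (1 <= m)%nat -> Cmod w = 1 -> Cmod z = 1 ->
  exists (k : Z) t, 0 <= t < 2 * PI / INR m /\
    z = (w * cis (2 * PI * IZR k / INR m + t))%C.
Proof.
intros Hm Hw Hz.
destruct (unit_cis w Hw) as [u ->]; destruct (unit_cis z Hz) as [x ->].
assert (Pm : 0 < INR m) by (apply lt_0_INR; lia).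
assert (HP := PI_RGT_0).
set (r := (x - u) * INR m / (2 * PI)).
destruct (archimed r) as [A1 A2].
exists (up r - 1)%Z, (x - u - 2 * PI * IZR (up r - 1) / INR m).
rewrite minus_IZR; split; [|rewrite cis_plus; f_equal; ring].
assert (Ex : x - u = 2 * PI * r / INR m) by (unfold r; field; lra).
rewrite Ex.
replace (2 * PI * r / INR m - 2 * PI * (IZR (up r) - 1) / INR m)
  with (2 * PI / INR m * (r - IZR (up r) + 1)) by (field; lra).
assert (0 < 2 * PI / INR m) by (apply Rdiv_lt_0_compat; lra).
split; nra.
Qed.

(** * The potential of a regular polygon *)

(** The cosecant is strictly midpoint convex between [0] and [PI]: by the inequality
    of the means it suffices that
    [sin x * sin y = (cos (x - y) - cos (x + y)) / 2 < sin ((x + y) / 2) ^ 2]. *)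
Lemma csc_midpoint x y : 0 < x < PI -> 0 < y < PI -> x <> y ->
  2 / sin ((x + y) / 2) < / sin x + / sin y.
Proof.
intros Hx Hy Hxy.
assert (S1 := sin_gt_0 x ltac:(lra) ltac:(lra)).
assert (S2 := sin_gt_0 y ltac:(lra) ltac:(lra)).
assert (S3 := sin_gt_0 ((x + y) / 2) ltac:(lra) ltac:(lra)).
assert (D : 0 < Rsqr (sin ((x - y) / 2))).
{ apply Rsqr_pos_lt; intros E.
  destruct (Rlt_dec x y) as [L|L].
  - assert (G := sin_gt_0 ((y - x) / 2) ltac:(lra) ltac:(lra)).
    replace ((y - x) / 2) with (- ((x - y) / 2)) in G by field.
    rewrite sin_neg in G; lra.
  - assert (G := sin_gt_0 ((x - y) / 2) ltac:(lra) ltac:(lra)); lra. }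
assert (E1 : cos (x - y) = 1 - 2 * Rsqr (sin ((x - y) / 2))).
{ unfold Rsqr; rewrite <- Rmult_assoc, <- cos_2a_sin; f_equal; field. }
assert (E2 : cos (x + y) = 1 - 2 * Rsqr (sin ((x + y) / 2))).
{ unfold Rsqr; rewrite <- Rmult_assoc, <- cos_2a_sin; f_equal; field. }
rewrite cos_minus in E1; rewrite cos_plus in E2.
set (p := sin x) in *; set (q := sin y) in *; set (s := sin ((x + y) / 2)) in *.
unfold Rsqr in *.
assert (L : p * q < s * s) by lra.
assert (G : 2 * (p * q) < (p + q) * s).
{ apply Rsqr_incrst_0; [|nra|nra].
  unfold Rsqr; apply Rlt_le_trans with (4 * (p * q) * (s * s)).
  - assert (0 < p * q) by nra; nra.
  - assert (0 <= Rsqr (p - q) * Rsqr s) by (apply Rmult_le_pos; apply Rle_0_sqr); unfold Rsqr in *; nra. }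
apply (Rmult_lt_reg_r (p * q * s)); [apply Rmult_lt_0_compat; nra|].
replace (2 / s * (p * q * s)) with (2 * (p * q)) by (field; lra).
replace ((/ p + / q) * (p * q * s)) with ((p + q) * s) by (field; lra).
exact G.
Qed.

(** The potential of the vertices of a regular [m]-gon, at an angle [t] past a
    vertex. *)
Definition gon_pot (m : nat) (t : R) : R :=
  lsum (fun j => / (2 * sin ((t + 2 * PI * INR j / INR m) / 2))) (seq 0 m).

Definition gon_min (m : nat) : R := gon_pot m (PI / INR m).

Lemma gon_angle (m j : nat) t : (j < m)%nat -> 0 < t < 2 * PI / INR m ->
  0 < (t + 2 * PI * INR j / INR m) / 2 < PI.
Proof.
intros Hj Ht.
assert (Pm : 0 < INR m) by (apply lt_0_INR; lia).
assert (HP := PI_RGT_0); assert (Ij := pos_INR j).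
assert (Hj' : INR j + 1 <= INR m) by (rewrite <- S_INR; apply le_INR; lia).
assert (0 < 2 * PI / INR m) by (apply Rdiv_lt_0_compat; lra).
replace (2 * PI * INR j / INR m) with (2 * PI / INR m * INR j) by (field; lra).
assert (E : 2 * PI / INR m * INR m = 2 * PI) by (field; lra).
split; [nra|].
assert (2 * PI / INR m * (INR j + 1) <= 2 * PI / INR m * INR m) by (apply Rmult_le_compat_l; lra).
lra.
Qed.

(** Reflection in the perpendicular bisector of an edge. *)
Lemma gon_pot_sym m t : (1 <= m)%nat ->
  gon_pot m (2 * PI / INR m - t) = gon_pot m t.
Proof.
intros Hm; unfold gon_pot; rewrite lsum_seq_rev; apply lsum_ext.
intros j Hj; apply in_seq in Hj; do 2 f_equal.
assert (Pm : 0 < INR m) by (apply lt_0_INR; lia).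
rewrite !minus_INR by lia; simpl INR.
rewrite <- sin_PI_x; f_equal; field; lra.
Qed.

(** Averaging the potential at [t] and at its mirror image pairs the terms of
    the sum, and each pair has its midpoint at the angle [PI / m]. *)
Lemma gon_pot_gt m t : (1 <= m)%nat -> 0 < t < 2 * PI / INR m ->
  t <> PI / INR m -> gon_min m < gon_pot m t.
Proof.
intros Hm Ht Hne.
assert (Pm : 0 < INR m) by (apply lt_0_INR; lia).
apply (Rmult_lt_reg_l 2); [lra|].
replace (2 * gon_pot m t) with (gon_pot m t + gon_pot m (2 * PI / INR m - t))
  by (rewrite gon_pot_sym by exact Hm; ring).
unfold gon_min, gon_pot; rewrite <- lsum_scal, <- lsum_plus.
apply lsum_lt; [destruct m; [lia|easy]|].
intros j Hj; apply in_seq in Hj.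
assert (A1 := gon_angle m j t ltac:(lia) Ht).
assert (A2 := gon_angle m j (2 * PI / INR m - t) ltac:(lia) ltac:(lra)).
assert (C := csc_midpoint _ _ A1 A2 ltac:(lra)).
replace (((t + 2 * PI * INR j / INR m) / 2 +
  (2 * PI / INR m - t + 2 * PI * INR j / INR m) / 2) / 2)
  with ((PI / INR m + 2 * PI * INR j / INR m) / 2) in C by (field; lra).
unfold Rdiv in C at 1; rewrite !Rinv_mult; lra.
Qed.

(** The vertices of the regular [m]-gon through [w]. *)
Definition rot (m : nat) (w z : C) : Prop :=
  exists k : Z, z = (w * cis (2 * PI * IZR k / INR m))%C.

(** The midpoints of the arcs between those vertices. *)
Definition mid (m : nat) (w z : C) : Prop :=
  exists k : Z, z = (w * cis (2 * PI * IZR k / INR m + PI / INR m))%C.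

Lemma rot_refl m w : rot m w w.
Proof.
exists 0%Z; replace (2 * PI * 0 / INR m) with (2 * PI * 0) by (unfold Rdiv; ring).
rewrite cis_2PI; ring.
Qed.

Lemma rot_double m w z : (1 <= m)%nat -> rot m w z -> rot (2 * m) w z.
Proof.
intros Hm [k ->]; exists (2 * k)%Z; do 2 f_equal.
assert (Pm : 0 < INR m) by (apply lt_0_INR; lia).
rewrite mult_IZR, mult_INR; simpl INR; field; lra.
Qed.

Lemma mid_double m w z : (1 <= m)%nat -> mid m w z -> rot (2 * m) w z.
Proof.
intros Hm [k ->]; exists (2 * k + 1)%Z; do 2 f_equal.
assert (Pm : 0 < INR m) by (apply lt_0_INR; lia).
rewrite plus_IZR, mult_IZR, mult_INR; simpl INR; field; lra.
Qed.

Lemma mid_rot m w u z : (1 <= m)%nat -> mid m w u -> rot m u z -> mid m w z.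
Proof.
intros Hm [k ->] [l ->]; exists (k + l)%Z.
rewrite <- Cmult_assoc, cis_plus; do 2 f_equal.
assert (Pm : 0 < INR m) by (apply lt_0_INR; lia).
rewrite plus_IZR; field; lra.
Qed.

Lemma mid_unit m w z : Cmod w = 1 -> mid m w z -> Cmod z = 1.
Proof. intros Hw [k ->]; rewrite Cmod_mult, Cmod_cis, Hw; ring. Qed.

(** * Minimizers of the potential *)

Definition pot (a : nat -> C) (N : nat) (z : C) : R :=
  lsum (fun k => / Cmod (z - a k)) (seq 0 N).

Definition avoids (a : nat -> C) (N : nat) (z : C) : Prop :=
  forall k, (k < N)%nat -> z <> a k.

(** Points of the circle where the potential is infinite are excluded on both
    sides, so that [pot] can be real-valued. *)
Definition minimizer (a : nat -> C) (N : nat) (z : C) : Prop :=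
  Cmod z = 1 /\ avoids a N z /\
  forall w, Cmod w = 1 -> avoids a N w -> pot a N z <= pot a N w.

(** At [k = 0] only [Cmod (a 0) = 1] is required, the potential being zero. *)
Definition greedy_upto (a : nat -> C) (N : nat) : Prop :=
  forall k, (k < N)%nat -> minimizer a k (a k).

Lemma greedy_upto_le a N M : (M <= N)%nat -> greedy_upto a N -> greedy_upto a M.
Proof. intros H G k Hk; apply G; lia. Qed.

Lemma avoids_NoDup a m :
  (forall i, (i < m)%nat -> avoids a i (a i)) -> NoDup (map a (seq 0 m)).
Proof.
induction m as [|m IH]; intros H; [constructor|].
rewrite seq_S, map_app; apply NoDup_app; simpl.
- apply IH; intros; apply H; lia.
- repeat constructor; easy.
- intros z Hz [<-|[]]; apply in_map_iff in Hz; destruct Hz as [k [E Hk]].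
  apply in_seq in Hk; apply (H m ltac:(lia) k ltac:(lia)); now symmetry.
Qed.

(** Being [m] distinct vertices, the points [a_i] exhaust the polygon.  The
    enumeration of the polygon starts at vertex [k] and runs backwards, so that
    the angles from its points to a point just past vertex [k] increase with [j]. *)
Lemma gon_perm a m (k : Z) : (1 <= m)%nat ->
  (forall i, (i < m)%nat -> rot m (a 0%nat) (a i)) ->
  (forall i, (i < m)%nat -> avoids a i (a i)) ->
  Permutation (map a (seq 0 m))
    (map (fun j => (a 0%nat * cis (2 * PI * (IZR k - INR j) / INR m))%C) (seq 0 m)).
Proof.
intros Hm Hrot Hav.
apply NoDup_Permutation_bis.
- now apply avoids_NoDup.
- now rewrite !length_map.
- intros z Hz; apply in_map_iff in Hz; destruct Hz as [i [<- Hi]]; apply in_seq in Hi.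
  destruct (Hrot i ltac:(lia)) as [l Hl].
  apply in_map_iff; exists (Z.to_nat ((k - l) mod Z.of_nat m)).
  assert (B := Z.mod_pos_bound (k - l) (Z.of_nat m) ltac:(lia)).
  split; [|apply in_seq; lia].
  (* The quotient of the division counts full turns. *)
  rewrite Hl, INR_IZR_INZ, Z2Nat.id by lia.
  set (q := ((k - l) / Z.of_nat m)%Z).
  rewrite <- (Cmult_1_r (cis (2 * PI * IZR l / INR m))), <- (cis_2PI q), cis_plus.
  do 2 f_equal.
  rewrite Zmod_eq_full by lia; fold q.
  rewrite !minus_IZR, mult_IZR, <- INR_IZR_INZ.
  assert (Pm : 0 < INR m) by (apply lt_0_INR; lia).
  field; lra.
Qed.

Lemma pot_gon a m (k : Z) t : (1 <= m)%nat ->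
  (forall i, (i < m)%nat -> rot m (a 0%nat) (a i)) ->
  (forall i, (i < m)%nat -> avoids a i (a i)) ->
  Cmod (a 0%nat) = 1 -> 0 < t < 2 * PI / INR m ->
  let z := (a 0%nat * cis (2 * PI * IZR k / INR m + t))%C in
  avoids a m z /\ pot a m z = gon_pot m t.
Proof.
intros Hm Hrot Hav H1 Ht z.
assert (HP := gon_perm a m k Hm Hrot Hav).
assert (Pm : 0 < INR m) by (apply lt_0_INR; lia).
assert (D : forall j, (j < m)%nat ->
  Cmod (z - a 0%nat * cis (2 * PI * (IZR k - INR j) / INR m))
    = 2 * sin ((t + 2 * PI * INR j / INR m) / 2) /\
  0 < sin ((t + 2 * PI * INR j / INR m) / 2)).
{ intros j Hj.
  assert (A := gon_angle m j t Hj Ht).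
  assert (SP := sin_gt_0 _ (proj1 A) (proj2 A)); split; [|exact SP].
  unfold z; replace (a 0%nat * cis (2 * PI * IZR k / INR m + t) -
    a 0%nat * cis (2 * PI * (IZR k - INR j) / INR m))%C
  with (a 0%nat * (cis (2 * PI * IZR k / INR m + t) - cis (2 * PI * (IZR k - INR j) / INR m)))%C by ring.
  rewrite Cmod_mult, H1, Cmod_cis_minus, Rmult_1_l.
  replace (2 * PI * IZR k / INR m + t - 2 * PI * (IZR k - INR j) / INR m)
    with (t + 2 * PI * INR j / INR m) by (field; lra).
  rewrite Rabs_right by lra; reflexivity. }
split.
- intros i Hi E.
  assert (I : In z (map a (seq 0 m))) by (rewrite E; apply in_map, in_seq; lia).
  apply (Permutation_in _ HP), in_map_iff in I; destruct I as [j [Ej Hj]].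
  apply in_seq in Hj; destruct (D j ltac:(lia)) as [D1 D2].
  rewrite Ej in D1; unfold Cminus in D1; rewrite Cplus_opp_r, Cmod_0 in D1; lra.
- unfold pot; rewrite <- (lsum_map (fun u => / Cmod (z - u)) a), (lsum_perm _ _ _ HP), lsum_map.
  apply lsum_ext; intros j Hj; apply in_seq in Hj; f_equal; apply D; lia.
Qed.

Lemma gon_minimizer a m : (1 <= m)%nat ->
  (forall i, (i < m)%nat -> rot m (a 0%nat) (a i)) ->
  (forall i, (i < m)%nat -> avoids a i (a i)) ->
  Cmod (a 0%nat) = 1 ->
  (forall z, mid m (a 0%nat) z -> avoids a m z /\ pot a m z = gon_min m) /\
  (forall z, Cmod z = 1 -> avoids a m z ->
     mid m (a 0%nat) z \/ gon_min m < pot a m z).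
Proof.
intros Hm Hrot Hav H1.
assert (Pm : 0 < INR m) by (apply lt_0_INR; lia).
assert (HP := PI_RGT_0).
assert (0 < PI / INR m) by (apply Rdiv_lt_0_compat; lra).
split.
- intros z [k ->]; apply pot_gon; try assumption.
  replace (2 * PI / INR m) with (2 * (PI / INR m)) by (field; lra); lra.
- intros z Hz Az.
  destruct (unit_arc (a 0%nat) z m Hm H1 Hz) as [k [t [Ht E]]].
  destruct (Req_dec t 0) as [T0|T0].
  (* At a vertex the potential is infinite. *)
  + exfalso.
    assert (I : In z (map a (seq 0 m))).
    { apply (Permutation_in _ (Permutation_sym (gon_perm a m k Hm Hrot Hav))).
      apply in_map_iff; exists 0%nat; split; [|apply in_seq; lia].
      rewrite E, T0; do 2 f_equal; simpl; field; lra. }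
    apply in_map_iff in I; destruct I as [i [Ei Hi]]; apply in_seq in Hi.
    apply (Az i); [lia|now symmetry].
  + destruct (pot_gon a m k t Hm Hrot Hav H1 ltac:(lra)) as [_ V]; rewrite <- E in V.
    destruct (Req_dec t (PI / INR m)) as [T|T].
    * left; exists k; now rewrite E, T.
    * right; rewrite V; apply gon_pot_gt; [exact Hm|lra|exact T].
Qed.

(** * The binary structure of greedy sequences *)

Definition tail (a : nat -> C) (m : nat) : nat -> C := fun j => a (m + j)%nat.

Lemma pot_split a m k z : pot a (m + k) z = pot a m z + pot (tail a m) k z.
Proof. apply lsum_seq_add. Qed.

Lemma avoids_split a m k z :
  avoids a (m + k) z <-> avoids a m z /\ avoids (tail a m) k z.
Proof.
split.
- intros H; split; intros i Hi; [apply H; lia|apply (H (m + i)%nat); lia].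
- intros [H1 H2] i Hi; destruct (Nat.lt_ge_cases i m) as [L|L]; [now apply H1|].
  replace i with (m + (i - m))%nat by lia; apply H2; lia.
Qed.

(** The induction hypothesis of the structure theorem.  Existence of a minimizer
    is carried along because it is what makes the two parts of a potential
    attain their minima at a common point; proving it here by induction spares
    a compactness argument. *)
Definition confined (n : nat) : Prop :=
  forall a N, (1 <= N < 2 ^ n)%nat -> greedy_upto a N ->
    (exists z, minimizer a N z) /\
    forall z, minimizer a N z -> rot (2 ^ n) (a 0%nat) z.

(** Past the [2^n]-gon, minimizing the whole potential amounts to minimizing the
    potential of the polygon and that of the tail separately: the tail is
    greedy, hence has a minimizer on the polygon through its first point, all
    of whose vertices are midpoints of the first polygon. *)
Lemma greedy_split n a k : confined n -> (k < 2 ^ n)%nat ->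
  greedy_upto a (2 ^ n + k) ->
  greedy_upto (tail a (2 ^ n)) k /\
  (forall z, mid (2 ^ n) (a 0%nat) z -> pot a (2 ^ n) z = gon_min (2 ^ n)) /\
  (forall z, minimizer a (2 ^ n + k) z <->
     mid (2 ^ n) (a 0%nat) z /\ minimizer (tail a (2 ^ n)) k z) /\
  (exists z, minimizer a (2 ^ n + k) z).
Proof.
intros Q Hk G; set (m := (2 ^ n)%nat) in *; set (b := tail a m).
assert (Hm : (1 <= m)%nat) by lia.
destruct (G 0%nat ltac:(lia)) as [H1 _].
assert (Hrot : forall i, (i < m)%nat -> rot m (a 0%nat) (a i)).
{ intros [|i] Hi; [apply rot_refl|].
  apply (Q a (S i)); [unfold m in Hi; lia|apply (greedy_upto_le _ (m + k)); [lia|exact G]|].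
  apply G; lia. }
assert (Hav : forall i, (i < m)%nat -> avoids a i (a i)).
{ intros i Hi; apply G; lia. }
destruct (gon_minimizer a m Hm Hrot Hav H1) as [M1 M2].
assert (Z0 : mid m (a 0%nat) (a 0%nat * cis (2 * PI * IZR 0 / INR m + PI / INR m))%C)
  by (now exists 0%Z).
assert (M0 : forall z, minimizer a m z <-> mid m (a 0%nat) z).
{ intros z; split.
  - intros [Hz [Az Lz]]; destruct (M2 z Hz Az) as [D|D]; [exact D|].
    destruct (M1 _ Z0) as [A0 V0].
    specialize (Lz _ (mid_unit _ _ _ H1 Z0) A0); lra.
  - intros Mz; destruct (M1 z Mz) as [Az Vz].
    split; [exact (mid_unit _ _ _ H1 Mz)|split; [exact Az|]].
    intros w Hw Aw; rewrite Vz.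
    destruct (M2 w Hw Aw) as [D|D]; [destruct (M1 w D) as [_ ->]; lra|lra]. }
assert (X : greedy_upto b k /\
  (forall z, minimizer a (m + k) z <-> mid m (a 0%nat) z /\ minimizer b k z) /\
  exists z, mid m (a 0%nat) z /\ minimizer b k z).
{ induction k as [|k IH].
  - assert (B0 : forall z, Cmod z = 1 -> minimizer b 0 z).
    { intros z Hz; split; [exact Hz|split; [intros i Hi; lia|]].
      intros; unfold pot; apply Rle_refl. }
    split; [intros i Hi; lia|]; split.
    + rewrite Nat.add_0_r; intros z; rewrite M0; split; [|tauto].
      intros Mz; split; [exact Mz|apply B0, (mid_unit _ _ _ H1 Mz)].
    + eexists; split; [exact Z0|apply B0, (mid_unit _ _ _ H1 Z0)].
  - destruct (IH ltac:(lia) (greedy_upto_le _ (m + S k) (m + k) ltac:(lia) G)) as [Gb [Ib _]].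
    assert (Gb' : greedy_upto b (S k)).
    { intros i Hi; destruct (Nat.eq_dec i k) as [->|Hne]; [|apply Gb; lia].
      apply Ib; apply (G (m + k)%nat); lia. }
    assert (B0 : mid m (a 0%nat) (b 0%nat)).
    { apply M0; unfold b, tail; rewrite Nat.add_0_r; apply G; lia. }
    destruct (Q b (S k) ltac:(unfold m in Hk; lia) Gb') as [[z0 Mz0] R0].
    assert (Nz : mid m (a 0%nat) z0) by (exact (mid_rot m _ (b 0%nat) _ Hm B0 (R0 z0 Mz0))).
    destruct (M1 z0 Nz) as [A0 V0].
    split; [exact Gb'|split; [|exists z0; now split]].
    intros z; split.
    + intros [Hz [Az Lz]]; apply avoids_split in Az; destruct Az as [Az1 Az2].
      destruct Mz0 as [Hz0 [Az0 Lz0]].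
      specialize (Lz z0 Hz0 ltac:(now apply avoids_split)).
      rewrite !pot_split in Lz; fold b in Lz, Az2.
      specialize (Lz0 z Hz Az2) as Lzz.
      destruct (M2 z Hz Az1) as [D|D]; [|lra].
      destruct (M1 z D) as [_ Vz].
      split; [exact D|split; [exact Hz|split; [exact Az2|]]].
      intros w Hw Aw; specialize (Lz0 w Hw Aw); lra.
    + intros [Mz [Hz [Az Lz]]]; destruct (M1 z Mz) as [Az1 Vz].
      split; [exact Hz|split; [now apply avoids_split|]].
      intros w Hw Aw; apply avoids_split in Aw; destruct Aw as [Aw1 Aw2].
      rewrite !pot_split; fold b; fold b in Aw2; specialize (Lz w Hw Aw2).
      destruct (M2 w Hw Aw1) as [D|D]; [destruct (M1 w D) as [_ E]; lra|lra]. }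
destruct X as [X1 [X2 [z X3]]].
split; [exact X1|split; [intros w Hw; now apply M1|split; [exact X2|]]].
exists z; now apply X2.
Qed.

(** The midpoints of the arcs of a polygon are vertices of the polygon with twice
    as many vertices. *)
Lemma confined_all n : confined n.
Proof.
induction n as [|n IH]; intros a N HN G; [simpl in HN; lia|].
assert (E : (2 ^ S n = 2 * 2 ^ n)%nat) by reflexivity; rewrite E in *.
assert (Hm : (1 <= 2 ^ n)%nat) by (generalize (Nat.pow_nonzero 2 n); lia).
destruct (Nat.lt_ge_cases N (2 ^ n)) as [L|L].
- destruct (IH a N ltac:(lia) G) as [X R]; split; [exact X|].
  intros z Hz; now apply rot_double, R.
- replace N with (2 ^ n + (N - 2 ^ n))%nat in * by lia.
  destruct (greedy_split n a (N - 2 ^ n) IH ltac:(lia) G) as [_ [_ [I X]]].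
  split; [exact X|]; intros z Hz; apply mid_double; [exact Hm|]; now apply I.
Qed.

Lemma sorted_sum_lt e n : StronglySorted gt e -> List.Forall (gt n) e ->
  (list_sum (map (Nat.pow 2) e) < 2 ^ n)%nat.
Proof.
intros H; revert n; induction H as [|x l Hl IH Hx]; intros n Hn; simpl.
- generalize (Nat.pow_nonzero 2 n); lia.
- inversion Hn; subst; specialize (IH x Hx).
  assert (2 ^ S x <= 2 ^ n)%nat by (apply Nat.pow_le_mono_r; lia).
  rewrite Nat.pow_succ_r' in *; lia.
Qed.

(** Each step of the recursion on the exponents removes the leading binary digit
    of [N] and passes to the tail. *)
Lemma minimizer_value a N e z : binary_exponents N e -> greedy_upto a N ->
  minimizer a N z -> pot a N z = lsum (fun i => gon_min (2 ^ i)) e.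
Proof.
intros [Hs HN]; revert a N HN; induction Hs as [|n e Hs IH Hn]; intros a N HN G M.
- simpl in HN; subst N; reflexivity.
- assert (L := sorted_sum_lt e n Hs Hn); set (N' := list_sum (map (Nat.pow 2) e)) in *.
  simpl in HN; fold N' in HN; subst N.
  destruct (greedy_split n a N' (confined_all n) L G) as [G' [V [I _]]].
  apply I in M; destruct M as [M1 M2].
  rewrite pot_split, (V z M1), (IH (tail a (2 ^ n)) N' eq_refl G' M2); reflexivity.
Qed.

(** * From extended real to real potentials *)

Lemma U_pot a N z : avoids a N z -> U a N z = Finite (pot a N z).
Proof.
induction N as [|N IH]; intros H; [reflexivity|].
simpl; rewrite IH by (intros k Hk; apply H; lia).
unfold inv_dist; destruct (Ceq_dec z (a N)) as [E|_]; [exfalso; apply (H N); auto|].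
unfold pot; rewrite lsum_seq_S; reflexivity.
Qed.

Lemma U_finite_avoids a N z : is_finite (U a N z) -> avoids a N z.
Proof.
induction N as [|N IH]; intros H k Hk; [lia|].
simpl in H; unfold inv_dist in H.
assert (P := U_ge0 a N z).
destruct (Ceq_dec z (a N)) as [E|E];
  destruct (U a N z) as [r| |] eqn:F; simpl in H, P; try easy.
destruct (Nat.eq_dec k N) as [->|Hne]; [exact E|].
apply IH; [reflexivity|lia].
Qed.

Lemma greedy_minimizer a N : greedy a -> minimizer a N (a N).
Proof.
intros H; assert (F := U_finite_avoids _ _ _ (greedy_U_finite a N H)).
destruct H as [H1 H2]; split; [apply H1|split; [exact F|]].
intros w Hw Aw; destruct N as [|N]; [apply Rle_refl|].
destruct (H2 (S N) ltac:(lia)) as [L _].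
assert (L' := L (U a (S N) w) (ex_intro _ w (conj Hw eq_refl))).
rewrite !U_pot in L' by assumption; exact L'.
Qed.

Lemma greedy_value a N e : greedy a -> binary_exponents N e ->
  real (U a N (a N)) = lsum (fun i => gon_min (2 ^ i)) e.
Proof.
intros H He; assert (M := greedy_minimizer a N H).
rewrite U_pot by apply M.
apply minimizer_value; [exact He|intros k _; now apply greedy_minimizer|exact M].
Qed.

(** * Asymptotics of the minimal polygon potential *)

Definition csc_gap (x : R) : R := / sin x - / x.

Lemma csc_gap_nonneg x : 0 < x <= PI / 2 -> 0 <= csc_gap x.
Proof.
intros Hx; assert (HP := PI_RGT_0).
assert (S := sin_gt_0 x ltac:(lra) ltac:(lra)); assert (L := sin_lt_x x ltac:(lra)).
unfold csc_gap; assert (/ x <= / sin x) by (apply Rinv_le_contravar; lra); lra.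
Qed.

(** From the Taylor bounds [x - x^3/6 <= sin x] and [cos x <= 1 - x^2/2 + x^4/24].
    This is the sign of the derivative of [csc_gap]. *)
Lemma cos_le_sinc_sqr x : 0 < x <= PI / 2 -> x * x * cos x < sin x * sin x.
Proof.
intros Hx; assert (HP4 := PI_4).
assert (S := proj1 (pre_sin_bound x 0 ltac:(lra) ltac:(lra))).
assert (C := proj2 (pre_cos_bound x 0 ltac:(lra) ltac:(lra))).
unfold sin_approx, sin_term, cos_approx, cos_term in S, C; simpl in S, C.
assert (S' : x - x * x * x / 6 <= sin x) by lra; clear S.
assert (C' : cos x <= 1 - x * x / 2 + x * x * (x * x) / 24) by lra; clear C.
set (y := x * x) in *; assert (Hy : 0 < y <= 4) by (unfold y; nra).
assert (S2 : y * ((1 - y / 6) * (1 - y / 6)) <= sin x * sin x).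
{ replace (y * ((1 - y / 6) * (1 - y / 6)))
    with ((x - y * x / 6) * (x - y * x / 6)) by (unfold y; field).
  assert (0 <= x - y * x / 6) by nra.
  apply Rmult_le_compat; lra. }
assert (y * cos x <= y * (1 - y / 2 + y * y / 24)) by (apply Rmult_le_compat_l; lra).
assert (0 < y * y * (1 / 6 - y / 72)) by (apply Rmult_lt_0_compat; nra).
nra.
Qed.

Lemma csc_gap_incr x y : 0 < x -> x <= y -> y <= PI / 2 -> csc_gap x <= csc_gap y.
Proof.
intros Hx Hxy Hy; destruct Hxy as [Hxy| ->]; [|lra]; assert (HP := PI_RGT_0).
apply Rlt_le, (incr_function_le csc_gap x y (fun t => / (t * t) - cos t / (sin t * sin t)));
  simpl; try lra; intros t H1 H2;
  assert (S := sin_gt_0 t ltac:(lra) ltac:(lra)).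
- unfold csc_gap; auto_derive; [repeat split; lra|field; lra].
- assert (C := cos_le_sinc_sqr t ltac:(lra)).
  replace (/ (t * t) - cos t / (sin t * sin t))
    with ((sin t * sin t - t * t * cos t) / (t * t * (sin t * sin t))) by (field; lra).
  apply Rdiv_lt_0_compat; [lra|repeat apply Rmult_lt_0_compat; lra].
Qed.

(** The primitive [ln (tan (x / 2)) - ln x] of [csc_gap], with [tan (x / 2)]
    written as [sin x / (1 + cos x)]: every factor is then positive
    for [0 < x <= PI / 2] and the limit at [0] is visible. *)
Definition csc_gap_prim (x : R) : R := ln (sin x / x) - ln (1 + cos x).

Lemma csc_gap_prim_derive x : 0 < x <= PI / 2 ->
  is_derive csc_gap_prim x (csc_gap x).
Proof.
intros Hx; assert (HP := PI_RGT_0).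
assert (S := sin_gt_0 x ltac:(lra) ltac:(lra)); assert (C := cos_ge_0 x ltac:(lra) ltac:(lra)).
unfold csc_gap_prim, csc_gap; auto_derive.
- repeat split; try lra; apply Rdiv_lt_0_compat; lra.
- generalize (sin2_cos2 x); unfold Rsqr; intros E.
  field_simplify_eq; [|repeat split; lra].
  nra.
Qed.

(** By the mean value theorem the integral is [(z - x) * csc_gap c] for some [c],
    and [csc_gap] is monotone. *)
Lemma csc_gap_midpoint x y z : 0 < x -> x <= y <= z -> z <= PI / 2 ->
  Rabs ((z - x) * csc_gap y - (csc_gap_prim z - csc_gap_prim x))
    <= (z - x) * (csc_gap z - csc_gap x).
Proof.
intros Hx Hy Hz.
destruct (MVT_gen csc_gap_prim x z csc_gap) as [c [Hc E]];
  rewrite Rmin_left, Rmax_right in * by lra.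
- intros t Ht; apply csc_gap_prim_derive; lra.
- intros t Ht; apply derivable_continuous_pt; exists (csc_gap t).
  apply is_derive_Reals, csc_gap_prim_derive; lra.
- rewrite E.
  assert (csc_gap x <= csc_gap y) by (apply csc_gap_incr; lra).
  assert (csc_gap y <= csc_gap z) by (apply csc_gap_incr; lra).
  assert (csc_gap x <= csc_gap c) by (apply csc_gap_incr; lra).
  assert (csc_gap c <= csc_gap z) by (apply csc_gap_incr; lra).
  apply Rabs_le; split; nra.
Qed.

(** A midpoint sum against the integral of [csc_gap] from [d] to [K d].  The error
    bounds of the steps telescope.  The first step starts at [0], where the
    primitive is undefined, so its whole contribution counts as error. *)
Lemma csc_gap_sum d K : 0 < d -> (1 <= K)%nat -> INR K * d <= PI / 2 ->
  Rabs (d * lsum (fun j => csc_gap ((2 * INR j + 1) * d / 2)) (seq 0 K)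
        - (csc_gap_prim (INR K * d) - csc_gap_prim d)) <= d * csc_gap (INR K * d).
Proof.
intros Hd; induction K as [|[|K] IH]; intros HK HB; [lia| |].
- unfold lsum; simpl in *.
  replace ((2 * 0 + 1) * d / 2) with (d / 2) by field.
  rewrite !Rmult_1_l in *.
  assert (0 <= csc_gap (d / 2)) by (apply csc_gap_nonneg; lra).
  assert (csc_gap (d / 2) <= csc_gap d) by (apply csc_gap_incr; lra).
  rewrite Rabs_right; nra.
- rewrite lsum_seq_S.
  rewrite (S_INR (S K)) in *.
  specialize (IH ltac:(lia) ltac:(nra)).
  assert (P : 0 < INR (S K)) by (apply lt_0_INR; lia).
  set (x := INR (S K)) in *.
  assert (M := csc_gap_midpoint (x * d) ((2 * x + 1) * d / 2) ((x + 1) * d)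
                 ltac:(nra) ltac:(nra) HB).
  replace ((x + 1) * d - x * d) with d in M by ring.
  set (s := lsum _ _) in *.
  assert (T := Rabs_triang
    (d * s - (csc_gap_prim (x * d) - csc_gap_prim d))
    (d * csc_gap ((2 * x + 1) * d / 2) - (csc_gap_prim ((x + 1) * d) - csc_gap_prim (x * d)))).
  match goal with |- Rabs ?g <= _ => match type of T with Rabs ?h <= _ =>
    replace g with h by ring end end.
  lra.
Qed.

Definition harmonic (N : nat) : R := sum_n_m (fun k => / INR k) 1 N.

Lemma harmonic_S N : harmonic (S N) = harmonic N + / INR (S N).
Proof. exact (sum_n_Sm (fun k => / INR k) 1 N ltac:(lia)). Qed.

(** The odd reciprocals are all reciprocals but the even ones. *)
Lemma odd_harmonic M :
  lsum (fun j => / (2 * INR j + 1)) (seq 0 M) = harmonic (2 * M) - harmonic M / 2.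
Proof.
induction M as [|M IH].
- unfold lsum, harmonic; simpl; rewrite sum_n_m_zero by lia; change (@zero _) with 0; field.
- replace (2 * S M)%nat with (S (S (2 * M))) by lia.
  rewrite lsum_seq_S, IH, !harmonic_S, !S_INR, mult_INR; simpl (INR 2).
  assert (0 <= INR M) by apply pos_INR; field; lra.
Qed.

(** The terms of [gon_min (2 M)] are symmetric about the angle [PI / 2], so that
    only angles [x <= PI / 2] matter; there [1 / sin x] is [1 / x] plus the
    bounded [csc_gap x]. *)
Lemma gon_min_even M : (1 <= M)%nat ->
  let d := PI / INR (2 * M) in
  d * gon_min (2 * M) = 2 * harmonic (2 * M) - harmonic M
    + d * lsum (fun j => csc_gap ((2 * INR j + 1) * d / 2)) (seq 0 M).
Proof.
intros HM d; assert (HP := PI_RGT_0).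
assert (P2 : 0 < INR (2 * M)) by (apply lt_0_INR; lia).
assert (Pd : 0 < d) by (apply Rdiv_lt_0_compat; lra).
assert (E : gon_min (2 * M) = lsum (fun j => / sin ((2 * INR j + 1) * d / 2)) (seq 0 M)).
{ set (F := fun j : nat => / (2 * sin ((PI / INR (2 * M) + 2 * PI * INR j / INR (2 * M)) / 2))).
  change (gon_min (2 * M)) with (lsum F (seq 0 (2 * M))).
  replace (2 * M)%nat with (M + M)%nat by lia.
  rewrite lsum_seq_add, (lsum_seq_rev (fun j => F (M + j)%nat)), <- lsum_plus.
  apply lsum_ext; intros j Hj; apply in_seq in Hj; unfold F.
  rewrite plus_INR, !minus_INR by lia; simpl (INR 1).
  replace ((PI / INR (2 * M) + 2 * PI * INR j / INR (2 * M)) / 2)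
    with ((2 * INR j + 1) * d / 2) by (unfold d; field; lra).
  replace ((PI / INR (2 * M) + 2 * PI * (INR M + (INR M - 1 - INR j)) / INR (2 * M)) / 2)
    with (PI - (2 * INR j + 1) * d / 2)
    by (unfold d; rewrite mult_INR in *; simpl (INR 2) in *; field; lra).
  rewrite sin_PI_x, Rinv_mult; lra. }
rewrite E, <- lsum_scal, <- lsum_scal.
replace (2 * harmonic (2 * M) - harmonic M) with (2 * (harmonic (2 * M) - harmonic M / 2)) by field.
rewrite <- odd_harmonic, <- lsum_scal, <- lsum_plus.
apply lsum_ext; intros j _; unfold csc_gap.
assert (0 <= INR j) by apply pos_INR.
rewrite Rmult_minus_distr_l; replace (d * / ((2 * INR j + 1) * d / 2)) with (2 * / (2 * INR j + 1)) by (field; lra).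
ring.
Qed.

Lemma harmonic_lim (phi : nat -> nat) : filterlim phi eventually eventually ->
  is_lim_seq (fun n => harmonic (phi n) - ln (INR (phi n))) euler_gamma.
Proof. intros H; exact (is_lim_seq_subseq _ _ phi H euler_gamma_lim). Qed.

(** Because [tan (x / 2) / x] tends to [1 / 2] at [0]. *)
Lemma csc_gap_prim_lim (d : nat -> R) : (forall n, d n <> 0) -> is_lim_seq d 0 ->
  is_lim_seq (fun n => csc_gap_prim (d n)) (- ln 2).
Proof.
intros Hd L.
replace (- ln 2) with (ln 1 - ln (1 + cos 0)) by (rewrite ln_1, cos_0; replace (1 + 1) with 2 by ring; ring).
unfold csc_gap_prim; apply is_lim_seq_minus'.
- apply (is_lim_seq_continuous ln (fun n => sin (d n) / d n) 1).
  + apply continuity_pt_filterlim, continuous_ln; lra.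
  + apply (is_lim_comp_seq (fun x => sin x / x) d 0 1 is_lim_sinc_0); [|exact L].
    exists 0%nat; intros n _ E; injection E; apply Hd.
- apply (is_lim_seq_continuous (fun x => ln (1 + cos x)) d 0); [|exact L].
  apply continuity_pt_filterlim, (continuous_comp (fun x => 1 + cos x) ln).
  + apply continuity_pt_filterlim, derivable_continuous_pt; reg.
  + apply continuous_ln; rewrite cos_0; lra.
Qed.

Definition gon_min_defect (m : nat) : R :=
  PI / INR m * gon_min m - ln (INR m) - (euler_gamma + ln (8 / PI)).

(** In [gon_min_even] the harmonic part contributes [ln m + gamma + ln 2], and
    the Riemann sum tends to the integral of [csc_gap] over the interval from [0] to
    [PI / 2], which is [ln (4 / PI)]. *)
Lemma gon_min_defect_lim : is_lim_seq (fun n => gon_min_defect (2 ^ n)) 0.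
Proof.
assert (HP := PI_RGT_0).
assert (Pow : forall n, (1 <= 2 ^ n)%nat) by (intros n; generalize (Nat.pow_nonzero 2 n); lia).
assert (Fp : filterlim (fun n => (2 ^ n)%nat) eventually eventually).
{ apply eventually_subseq; intros n; apply Nat.pow_lt_mono_r; lia. }
assert (Fs : filterlim (fun n => (2 ^ S n)%nat) eventually eventually).
{ apply eventually_subseq; intros n; apply Nat.pow_lt_mono_r; lia. }
apply is_lim_seq_incr_1.
set (d := fun n => PI / INR (2 ^ S n)).
set (s := fun n => lsum (fun j => csc_gap ((2 * INR j + 1) * d n / 2)) (seq 0 (2 ^ n))).
assert (PN : forall n, 0 < INR (2 ^ n)) by (intros n; apply lt_0_INR; specialize (Pow n); lia).
assert (Pd : forall n, 0 < d n) by (intros n; apply Rdiv_lt_0_compat; auto).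
assert (Ed : forall n, INR (2 ^ n) * d n = PI / 2).
{ intros n; unfold d; rewrite Nat.pow_succ_r', mult_INR; simpl (INR 2).
  specialize (PN n); field; lra. }
assert (Ld : is_lim_seq d 0).
{ replace (Finite 0) with (Rbar_mult PI (Rbar_inv p_infty)) by (simpl; f_equal; ring).
  apply is_lim_seq_scal_l, is_lim_seq_inv; [|easy].
  exact (is_lim_seq_subseq _ _ _ Fs is_lim_seq_INR). }
assert (Ls : is_lim_seq (fun n => d n * s n) (ln (4 / PI))).
{ set (g := fun n => csc_gap_prim (PI / 2) - csc_gap_prim (d n)).
  assert (Lg : is_lim_seq g (ln (4 / PI))).
  { replace (ln (4 / PI)) with (csc_gap_prim (PI / 2) - (- ln 2)).
    - apply is_lim_seq_minus'; [apply is_lim_seq_const|].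
      apply csc_gap_prim_lim; [intros n; specialize (Pd n); lra|exact Ld].
    - unfold csc_gap_prim; rewrite sin_PI2, cos_PI2, Rplus_0_r, ln_1.
      replace (4 / PI) with (1 / (PI / 2) * 2) by (field; lra).
      rewrite (ln_mult (1 / (PI / 2))) by (try apply Rdiv_lt_0_compat; lra); ring. }
  apply is_lim_seq_ext with (fun n => g n + (d n * s n - g n)); [intros; ring|].
  replace (ln (4 / PI)) with (ln (4 / PI) + 0) by ring.
  apply is_lim_seq_plus'; [exact Lg|].
  apply is_lim_seq_abs_0, (is_lim_seq_le_le (fun _ => 0) _ (fun n => d n * csc_gap (PI / 2))).
  - intros n; split; [apply Rabs_pos|].
    unfold g; rewrite <- (Ed n); apply csc_gap_sum; [apply Pd|apply Pow|rewrite Ed; lra].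
  - apply is_lim_seq_const.
  - replace (Finite 0) with (Finite (0 * csc_gap (PI / 2))) by (f_equal; ring).
    apply is_lim_seq_mult'; [exact Ld|apply is_lim_seq_const]. }
apply is_lim_seq_ext with (fun n =>
  2 * (harmonic (2 ^ S n) - ln (INR (2 ^ S n)))
  - (harmonic (2 ^ n) - ln (INR (2 ^ n)))
  + d n * s n - (euler_gamma + ln (8 / PI) - ln 2)).
- intros n; unfold gon_min_defect.
  rewrite Nat.pow_succ_r'.
  generalize (gon_min_even (2 ^ n) (Pow n)); cbv zeta; intros ->.
  unfold s, d; rewrite Nat.pow_succ_r'.
  assert (El : ln (INR (2 * 2 ^ n)) = ln 2 + ln (INR (2 ^ n))).
  { rewrite mult_INR; simpl (INR 2); rewrite ln_mult; [f_equal; f_equal; ring|lra|apply PN]. }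
  rewrite El; ring.
- replace 0 with (2 * euler_gamma - euler_gamma + ln (4 / PI) - (euler_gamma + ln (8 / PI) - ln 2)).
  + apply is_lim_seq_minus'; [|apply is_lim_seq_const].
    apply is_lim_seq_plus'; [|exact Ls].
    apply is_lim_seq_minus'; [|now apply harmonic_lim].
    apply is_lim_seq_mult'; [apply is_lim_seq_const|now apply (harmonic_lim (fun n => (2 ^ S n)%nat))].
  + replace (8 / PI) with (2 * (4 / PI)) by (field; lra).
    rewrite ln_mult; [ring|lra|apply Rdiv_lt_0_compat; lra].
Qed.

(** * Binary expansions and their weights *)

Definition weights (N : nat) (e : list nat) : list R :=
  map (fun i => 2 ^ i / INR N) e.

Lemma lsum_pow2 N e : binary_exponents N e -> lsum (fun i => 2 ^ i) e = INR N.
Proof.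
intros [_ ->]; unfold lsum; induction e as [|i e IH]; [reflexivity|].
simpl map; simpl list_sum; simpl fold_right; rewrite plus_INR, pow_INR, IH; reflexivity.
Qed.

Lemma exponent_pow_le N e i : binary_exponents N e -> In i e -> (2 ^ i <= N)%nat.
Proof.
intros [_ ->]; induction e as [|n e IH]; [easy|]; intros [->|H]; simpl; [lia|].
specialize (IH H); lia.
Qed.

Lemma binary_exponents_exist N : exists e, binary_exponents N e.
Proof.
induction N as [N IH] using lt_wf_ind.
destruct (Nat.eq_dec N 0) as [->|H0]; [exists []; split; [constructor|reflexivity]|].
destruct (Nat.log2_spec N ltac:(lia)) as [L1 L2].
set (n := Nat.log2 N) in *; rewrite Nat.pow_succ_r' in L2.
assert (P : (2 ^ n <> 0)%nat) by (apply Nat.pow_nonzero; lia).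
destruct (IH (N - 2 ^ n)%nat ltac:(lia)) as [e He].
exists (n :: e); split.
- constructor; [apply He|]; apply Forall_forall; intros i Hi.
  assert (Q := exponent_pow_le _ _ _ He Hi).
  apply (Nat.pow_lt_mono_r_iff 2); lia.
- simpl; destruct He as [_ He]; lia.
Qed.

Lemma testbit_exponents N e i : binary_exponents N e ->
  Nat.testbit N i = true <-> In i e.
Proof.
intros [Hs HN]; revert N HN; induction Hs as [|n e Hs IH Hn]; intros N HN.
- simpl in HN; subst N; rewrite Nat.bits_0; split; [easy|intros []].
- assert (L := sorted_sum_lt e n Hs Hn).
  simpl in HN; set (r := list_sum (map (Nat.pow 2) e)) in *.
  assert (Z : Nat.land (2 ^ n) r = 0%nat).
  { apply Nat.bits_inj; intros k; rewrite Nat.land_spec, Nat.bits_0, Nat.pow2_bits_eqb.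
    destruct (Nat.eqb_spec n k) as [<-|E]; [|reflexivity].
    rewrite Nat.testbit_eqb, Nat.div_small by exact L; reflexivity. }
  rewrite HN, Nat.add_nocarry_lxor, Nat.lxor_spec, Nat.pow2_bits_eqb by exact Z.
  assert (T : Nat.testbit r n = false)
    by (rewrite Nat.testbit_eqb, Nat.div_small by exact L; reflexivity).
  specialize (IH r eq_refl); simpl.
  destruct (Nat.eqb_spec n i) as [<-|E]; [rewrite T; simpl; tauto|].
  rewrite Bool.xorb_false_l, IH; tauto.
Qed.

Lemma sorted_gt_NoDup e : StronglySorted gt e -> NoDup e.
Proof.
induction 1 as [|n e Hs IH Hn]; constructor; [|exact IH].
intros I; rewrite Forall_forall in Hn; specialize (Hn n I); lia.
Qed.

Lemma tau_b_length N e : binary_exponents N e -> tau_b N = length e.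
Proof.
intros H; unfold tau_b; apply Permutation_length, NoDup_Permutation.
- apply NoDup_filter, seq_NoDup.
- apply sorted_gt_NoDup, H.
- intros i; rewrite filter_In, (testbit_exponents N e i H), in_seq; split; [tauto|].
  intros I; split; [|exact I].
  assert (Q := exponent_pow_le _ _ _ H I).
  assert (i < 2 ^ i)%nat by (apply Nat.pow_gt_lin_r; lia); lia.
Qed.

Lemma nth_weights N e k : (k < length e)%nat ->
  nth k (weights N e) 0 = 2 ^ nth k e 0%nat / INR N.
Proof.
intros H; unfold weights.
rewrite (nth_indep _ 0 (2 ^ 0 / INR N)) by now rewrite length_map.
exact (map_nth (fun i => 2 ^ i / INR N) e 0%nat k).
Qed.

(** The numbers [N * 2^j] all have the weights of [N]: their exponents are
    shifted by [j]. *)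
Lemma Theta_weights N e : (1 <= N)%nat -> binary_exponents N e -> Theta (weights N e).
Proof.
intros HN H; exists (length e); split.
{ destruct e; [destruct H as [_ ->]; simpl in HN; lia|simpl; lia]. }
split; [apply length_map|].
assert (HS : forall j, binary_exponents (N * 2 ^ j) (map (fun i => i + j)%nat e)).
{ intros j; destruct H as [Hs ->]; split.
  - clear HN; induction Hs as [|n l Hs IH Hn]; [constructor|].
    simpl; constructor; [exact IH|].
    apply Forall_map; revert Hn; apply Forall_impl; intros; lia.
  - clear; induction e as [|n l IH]; simpl; [reflexivity|].
    rewrite Nat.mul_add_distr_r, IH, Nat.pow_add_r; reflexivity. }
assert (P2 : forall j, (1 <= 2 ^ j)%nat) by (intros j; generalize (Nat.pow_nonzero 2 j); lia).
exists (fun j => (N * 2 ^ j)%nat), (fun j => map (fun i => i + j)%nat e).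
split; [|split].
- intros j; apply Nat.mul_lt_mono_pos_l; [lia|apply Nat.pow_lt_mono_r; lia].
- intros j; specialize (P2 j); split; [nia|].
  assert (El := length_map (fun i => i + j)%nat e).
  rewrite (tau_b_length _ _ (HS j)); auto.
- intros k Hk; rewrite nth_weights by exact Hk.
  apply is_lim_seq_ext with (fun _ => 2 ^ nth k e 0%nat / INR N); [|apply is_lim_seq_const].
  intros j; rewrite (nth_indep (map _ e) 0%nat (0 + j)%nat) by now rewrite length_map.
  rewrite (map_nth (fun i => i + j)%nat), pow_add, mult_INR, pow_INR.
  change (INR 2) with 2.
  assert (0 < INR N) by (apply lt_0_INR; lia).
  assert (0 < 2 ^ j) by (apply pow_lt; lra).
  field; lra.
Qed.

Lemma Lambda_weights_le0 N e : (1 <= N)%nat -> binary_exponents N e ->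
  Lambda (weights N e) <= 0.
Proof.
intros HN H; unfold weights; change (Lambda ?l) with (lsum (fun t => t * ln t) l).
rewrite lsum_map; replace 0 with (0 * lsum (fun _ => 0) e) by ring.
rewrite <- lsum_scal; apply lsum_le; intros i Hi.
assert (PN : 0 < INR N) by (apply lt_0_INR; lia).
assert (Q := le_INR _ _ (exponent_pow_le _ _ _ H Hi)); rewrite pow_INR in Q.
change (INR 2) with 2 in Q; assert (0 < 2 ^ i) by (apply pow_lt; lra).
assert (B : 0 < 2 ^ i / INR N <= 1).
{ split; [apply Rdiv_lt_0_compat; lra|].
  apply (Rmult_le_reg_r (INR N)); [lra|]; unfold Rdiv; rewrite Rmult_assoc, Rinv_l; lra. }
assert (ln (2 ^ i / INR N) <= 0) by (rewrite <- ln_1; apply ln_le; lra).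
nra.
Qed.

Lemma lambda_le_weights N e : (1 <= N)%nat -> binary_exponents N e ->
  lambda <= Lambda (weights N e).
Proof.
intros HN H; apply (proj1 lambda_glb (Lambda (weights N e))).
exists (weights N e); split; [now apply Theta_weights|reflexivity].
Qed.

(** * Limit points of the normalized potential *)

(** [N ln N] is distributed over the binary digits of [N], which turns
    [ln (2^n_k)] into [ln (2^n_k / N)]. *)
Lemma normalized_U_value a n e : greedy a -> binary_exponents (S n) e ->
  normalized_U a n = 1 / PI * (euler_gamma + ln (8 / PI) + Lambda (weights (S n) e))
    + 1 / PI * (lsum (fun i => 2 ^ i * gon_min_defect (2 ^ i)) e / INR (S n)).
Proof.
intros Ha He; unfold normalized_U; cbv zeta; rewrite (greedy_value a (S n) e Ha He).
assert (PN : 0 < INR (S n)) by (apply lt_0_INR; lia).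
assert (HP := PI_RGT_0).
set (x := INR (S n)) in *; set (c := euler_gamma + ln (8 / PI)).
assert (E : PI * lsum (fun i => gon_min (2 ^ i)) e =
  x * Lambda (weights (S n) e) + (c + ln x) * x
  + lsum (fun i => 2 ^ i * gon_min_defect (2 ^ i)) e).
{ change (Lambda ?l) with (lsum (fun t => t * ln t) l); unfold weights.
  fold x; unfold x at 4; rewrite <- (lsum_pow2 _ _ He), lsum_map, <- !lsum_scal, <- !lsum_plus.
  apply lsum_ext; intros i _; fold x; unfold gon_min_defect; fold c.
  rewrite pow_INR; change (INR 2) with 2.
  assert (0 < 2 ^ i) by (apply pow_lt; lra).
  rewrite (ln_div (2 ^ i) x) by lra; field; lra. }
apply (Rmult_eq_reg_l (PI * x)); [|apply Rmult_integral_contrapositive_currified; lra].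
transitivity (PI * lsum (fun i => gon_min (2 ^ i)) e - x * ln x); [field; lra|].
rewrite E; field; lra.
Qed.

(** Distinct exponents below a fixed [i0] have total weight less than [2^i0 / N],
    so for large [N] almost all the weight is on exponents where [c] is small. *)
Lemma dyadic_average (c : nat -> R) : is_lim_seq c 0 -> forall eps, 0 < eps ->
  exists N0, forall N e, (N0 <= N)%nat -> binary_exponents N e ->
    Rabs (lsum (fun i => 2 ^ i * c i) e / INR N) <= eps.
Proof.
intros Hc eps He.
destruct (maj_by_pos c) as [B [HB Hb]]; [exists 0; now apply is_lim_seq_Reals|].
apply is_lim_seq_spec in Hc; destruct (Hc (mkposreal (eps / 2) ltac:(lra))) as [i0 H0].
simpl in H0.
assert (K : forall e, StronglySorted gt e ->
  lsum (fun i => 2 ^ i * Rabs (c i)) e <= eps / 2 * lsum (fun i => 2 ^ i) e + B * 2 ^ i0).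
{ assert (P0 : 0 < 2 ^ i0) by (apply pow_lt; lra).
  induction 1 as [|n e Hs IH Hn]; [unfold lsum; simpl; nra|].
  destruct (Nat.lt_ge_cases n i0) as [L|L].
  - assert (Ss : StronglySorted gt (n :: e)) by now constructor.
    assert (Q : (list_sum (map (Nat.pow 2) (n :: e)) < 2 ^ i0)%nat).
    { apply sorted_sum_lt; [exact Ss|].
      constructor; [lia|revert Hn; apply Forall_impl; intros; lia]. }
    apply lt_INR in Q; rewrite <- (lsum_pow2 _ _ (conj Ss eq_refl)), pow_INR in Q.
    change (INR 2) with 2 in Q.
    assert (lsum (fun i => 2 ^ i * Rabs (c i)) (n :: e) <= lsum (fun i => B * 2 ^ i) (n :: e)).
    { apply lsum_le; intros i _; rewrite Rmult_comm.
      apply Rmult_le_compat_r; [apply pow_le; lra|apply Hb]. }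
    rewrite (lsum_scal B (fun i => 2 ^ i)) in *.
    assert (0 <= lsum (fun i => 2 ^ i) (n :: e)).
    { rewrite (lsum_pow2 _ _ (conj Ss eq_refl)); apply pos_INR. }
    set (s := lsum (fun i => 2 ^ i) (n :: e)) in *.
    assert (B * s <= B * 2 ^ i0) by (apply Rmult_le_compat_l; lra).
    assert (0 <= eps / 2 * s) by (apply Rmult_le_pos; lra); lra.
  - unfold lsum in *; simpl.
    specialize (H0 n L); rewrite Rminus_0_r in H0.
    assert (0 < 2 ^ n) by (apply pow_lt; lra); nra. }
destruct (nfloor_ex (B * 2 ^ i0 * (2 / eps))) as [k [_ Hk]].
{ assert (0 < 2 ^ i0) by (apply pow_lt; lra).
  assert (0 < 2 / eps) by (apply Rdiv_lt_0_compat; lra); apply Rmult_le_pos; nra. }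
exists (S k); intros N e HN Hbin.
assert (PN : 0 < INR N) by (apply lt_0_INR; lia).
specialize (K e (proj1 Hbin)); rewrite (lsum_pow2 _ _ Hbin) in K.
apply le_INR in HN; rewrite S_INR in HN.
assert (Q : B * 2 ^ i0 <= eps / 2 * INR N).
{ apply (Rmult_le_reg_r (2 / eps)); [apply Rdiv_lt_0_compat; lra|].
  replace (eps / 2 * INR N * (2 / eps)) with (INR N) by (field; lra); lra. }
assert (T : Rabs (lsum (fun i => 2 ^ i * c i) e) <= lsum (fun i => 2 ^ i * Rabs (c i)) e).
{ clear; unfold lsum; induction e as [|i e IH]; simpl; [rewrite Rabs_R0; lra|].
  eapply Rle_trans; [apply Rabs_triang|]; apply Rplus_le_compat; [|exact IH].
  rewrite Rabs_mult, (Rabs_pos_eq (2 ^ i)) by (apply pow_le; lra); lra. }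
unfold Rdiv; rewrite Rabs_mult, (Rabs_pos_eq (/ INR N)) by (apply Rlt_le, Rinv_0_lt_compat, PN).
apply (Rmult_le_reg_r (INR N)); [exact PN|].
rewrite Rmult_assoc, Rinv_l by lra; lra.
Qed.

Lemma normalized_U_approx a : greedy a -> forall eps, 0 < eps ->
  exists n0, forall n e, (n0 <= n)%nat -> binary_exponents (S n) e ->
    Rabs (normalized_U a n
          - 1 / PI * (euler_gamma + ln (8 / PI) + Lambda (weights (S n) e))) <= eps.
Proof.
intros Ha eps He; assert (HP := PI_RGT_0).
destruct (dyadic_average _ gon_min_defect_lim (PI * eps)) as [N0 H0]; [nra|].
exists N0; intros n e Hn Hb; rewrite (normalized_U_value a n e Ha Hb).
specialize (H0 (S n) e ltac:(lia) Hb).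
match goal with |- Rabs (?p + 1 / PI * ?q - ?p) <= _ =>
  replace (p + 1 / PI * q - p) with (/ PI * q) by (unfold Rdiv; ring) end.
rewrite Rabs_mult, Rabs_pos_eq by (apply Rlt_le, Rinv_0_lt_compat, HP).
apply (Rmult_le_reg_l PI); [exact HP|].
rewrite <- Rmult_assoc, Rinv_r by lra; lra.
Qed.

(** At [l = 0] the bound [ln (1 / s) <= 1 / s - 1] with [s = sqrt t] gives
    [- 2 sqrt t <= t ln t <= 0]. *)
Lemma xlnx_lim (u : nat -> R) (l : R) : (forall n, 0 < u n <= 1) -> 0 <= l ->
  is_lim_seq u l -> is_lim_seq (fun n => u n * ln (u n)) (l * ln l).
Proof.
intros Hu [Hl|<-] L.
- apply is_lim_seq_mult'; [exact L|].
  apply is_lim_seq_continuous; [|exact L].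
  now apply continuity_pt_filterlim, continuous_ln.
- rewrite Rmult_0_l.
  apply (is_lim_seq_le_le (fun n => - 2 * sqrt (u n)) _ (fun _ => 0)).
  + intros n; specialize (Hu n).
    assert (Hs := sqrt_lt_R0 (u n) (proj1 Hu)).
    assert (Es := sqrt_sqrt (u n) ltac:(lra)); set (s := sqrt (u n)) in *.
    rewrite <- Es, ln_mult by exact Hs.
    assert (L1 := ln_le_sub1 (/ s) ltac:(now apply Rinv_0_lt_compat)).
    rewrite ln_Rinv in L1 by exact Hs.
    assert (E : s * / s = 1) by (field; lra).
    assert (L2 : ln s <= 0) by (rewrite <- ln_1; apply ln_le; nra).
    split; nra.
  + replace 0 with (- 2 * sqrt 0) by (rewrite sqrt_0; ring).
    apply is_lim_seq_mult'; [apply is_lim_seq_const|].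
    apply is_lim_seq_continuous; [apply continuity_pt_sqrt; lra|exact L].
  + apply is_lim_seq_const.
Qed.

Lemma Lambda_nth l :
  Lambda l = lsum (fun k => nth k l 0 * ln (nth k l 0)) (seq 0 (length l)).
Proof.
change (Lambda l) with (lsum (fun t => t * ln t) l).
rewrite <- (lsum_map (fun t => t * ln t) (fun k => nth k l 0)); f_equal.
symmetry; apply nth_ext with 0 0; rewrite length_map, length_seq; [reflexivity|].
intros k Hk; rewrite (nth_indep _ 0 (nth 0 l 0)) by now rewrite length_map, length_seq.
rewrite (map_nth (fun k => nth k l 0)), seq_nth by exact Hk; reflexivity.
Qed.

Lemma Theta_limit_point a theta : greedy a -> Theta theta ->
  limit_point (normalized_U a)
    (1 / PI * (euler_gamma + ln (8 / PI) + Lambda theta)).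
Proof.
intros Ha [p [Hp HT]]; assert (Bd := fun k => Theta_bounds p theta k HT).
destruct HT as [Hlen [N [e [HN [He HL]]]]].
assert (HNj : forall j, S (N j - 1) = N j) by (intros j; destruct (He j); lia).
assert (Hge : forall j, (j < N j)%nat).
{ induction j as [|j IH]; [destruct (He 0%nat); lia|specialize (HN j); lia]. }
exists (fun j => (N j - 1)%nat); split.
{ intros j; specialize (HN j); specialize (HNj j); lia. }
assert (LL : is_lim_seq (fun j => Lambda (weights (N j) (e j))) (Lambda theta)).
{ rewrite Lambda_nth, Hlen.
  apply is_lim_seq_ext with (fun j => lsum (fun k =>
    2 ^ nth k (e j) 0%nat / INR (N j) * ln (2 ^ nth k (e j) 0%nat / INR (N j))) (seq 0 p)).
  { intros j; destruct (He j) as [_ [_ [El _]]].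
    rewrite Lambda_nth; unfold weights at 3; rewrite length_map, El.
    apply lsum_ext; intros k Hk; apply in_seq in Hk; rewrite nth_weights by lia; reflexivity. }
  assert (T : forall k, (k < p)%nat -> is_lim_seq (fun j =>
      2 ^ nth k (e j) 0%nat / INR (N j) * ln (2 ^ nth k (e j) 0%nat / INR (N j)))
      (nth k theta 0 * ln (nth k theta 0))).
  { intros k Hk; apply (xlnx_lim (fun j => 2 ^ nth k (e j) 0%nat / INR (N j)));
      [|apply Bd, Hk|apply HL, Hk].
    intros j; destruct (He j) as [H1 [_ [El Hb]]].
    assert (PN : 0 < INR (N j)) by (apply lt_0_INR; lia).
    assert (I : In (nth k (e j) 0%nat) (e j)) by (apply nth_In; lia).
    assert (Q := le_INR _ _ (exponent_pow_le _ _ _ Hb I)).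
    rewrite pow_INR in Q; change (INR 2) with 2 in Q.
    split; [apply Rdiv_lt_0_compat; [apply pow_lt; lra|lra]|].
    apply (Rmult_le_reg_r (INR (N j))); [lra|].
    unfold Rdiv; rewrite Rmult_assoc, Rinv_l; lra. }
  clear - T; induction p as [|p IH]; [apply is_lim_seq_const|].
  rewrite lsum_seq_S; eapply is_lim_seq_ext; [intros j; symmetry; apply lsum_seq_S|].
  apply is_lim_seq_plus'; [apply IH; intros; apply T; lia|apply T; lia]. }
assert (D : is_lim_seq (fun j => normalized_U a (N j - 1)
   - 1 / PI * (euler_gamma + ln (8 / PI) + Lambda (weights (N j) (e j)))) 0).
{ apply is_lim_seq_spec; intros [eps Heps]; simpl.
  destruct (normalized_U_approx a Ha (eps / 2) ltac:(lra)) as [n0 H0].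
  exists n0; intros j Hj; rewrite Rminus_0_r.
  specialize (H0 (N j - 1)%nat (e j)); rewrite HNj in H0.
  apply Rle_lt_trans with (eps / 2); [|lra].
  apply H0; [specialize (Hge j); lia|apply He]. }
set (c := euler_gamma + ln (8 / PI)) in *.
apply is_lim_seq_ext with (fun j => 1 / PI * (c + Lambda (weights (N j) (e j)))
  + (normalized_U a (N j - 1) - 1 / PI * (c + Lambda (weights (N j) (e j))))).
{ intros j; ring. }
replace (1 / PI * (c + Lambda theta)) with (1 / PI * (c + Lambda theta) + 0) by ring.
apply is_lim_seq_plus'; [|exact D].
apply is_lim_seq_mult'; [apply is_lim_seq_const|].
apply is_lim_seq_plus'; [apply is_lim_seq_const|exact LL].
Qed.

Lemma limit_point_frequently u l : limit_point u l -> forall eps, 0 < eps ->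
  forall N, exists n, (N <= n)%nat /\ l - eps < u n < l + eps.
Proof.
intros [phi [Hphi L]] eps He N.
apply is_lim_seq_spec in L; destruct (L (mkposreal eps He)) as [n0 H0]; simpl in H0.
assert (Hge : forall i, (i <= phi i)%nat).
{ induction i as [|i IH]; [lia|specialize (Hphi i); lia]. }
exists (phi (N + n0)%nat); split; [specialize (Hge (N + n0)%nat); lia|].
specialize (H0 (N + n0)%nat ltac:(lia)); apply Rabs_def2 in H0; lra.
Qed.

Lemma limit_point_lim u l l' : limit_point u l -> is_lim_seq u l' -> Finite l = l'.
Proof.
intros [phi [Hphi L]] L'.
apply (is_lim_seq_subseq u l' phi) in L'; [|now apply eventually_subseq].
apply is_lim_seq_unique in L, L'; rewrite L in L'; exact L'.
Qed.

Lemma eventually_bounded (u : nat -> R) (n0 : nat) K :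
  (forall n, (n0 <= n)%nat -> Rabs (u n) <= K) -> exists M, forall n, Rabs (u n) <= M.
Proof.
revert K; induction n0 as [|m IH]; intros K H.
- exists K; intros n; apply H; lia.
- apply (IH (Rmax K (Rabs (u m)))); intros n Hn.
  destruct (Nat.eq_dec n m) as [->|Hne]; [apply Rmax_r|].
  eapply Rle_trans; [apply H; lia|apply Rmax_l].
Qed.

Theorem theorem1p6 (a : nat -> C) (Ha : greedy a) :
  (exists M : R, forall n : nat, Rabs (normalized_U a n) <= M) /\
  ~ ex_finite_lim_seq (normalized_U a) /\
  LimSup_seq (normalized_U a)
    = Finite (1 / PI * (euler_gamma + ln (8 / PI))) /\
  LimInf_seq (normalized_U a)
    = Finite (1 / PI * (euler_gamma + ln (8 / PI) + lambda)) /\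
  (forall theta : list R, Theta theta ->
     limit_point (normalized_U a)
       (1 / PI * (euler_gamma + ln (8 / PI) + Lambda theta))).
Proof.
assert (HP := PI_RGT_0); assert (IP := Rinv_0_lt_compat _ HP).
assert (LP := fun theta => Theta_limit_point a theta Ha).
set (c := euler_gamma + ln (8 / PI)) in *.
assert (LP1 : limit_point (normalized_U a) (1 / PI * c)).
{ replace c with (c + Lambda [1]); [apply LP, Theta_one|].
  unfold Lambda; simpl; rewrite ln_1; ring. }
assert (bounds : forall eps, 0 < eps -> exists n0, forall n, (n0 <= n)%nat ->
  1 / PI * (c + lambda) - eps <= normalized_U a n <= 1 / PI * c + eps).
{ intros eps He; destruct (normalized_U_approx a Ha eps He) as [n0 H0].
  exists n0; intros n Hn; destruct (binary_exponents_exist (S n)) as [e Hb].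
  specialize (H0 n e Hn Hb); fold c in H0; apply Rabs_le_between in H0.
  assert (L1 := Lambda_weights_le0 (S n) e ltac:(lia) Hb).
  assert (L2 := lambda_le_weights (S n) e ltac:(lia) Hb).
  unfold Rdiv in *; rewrite !Rmult_1_l in *.
  split; nra. }
split; [|split; [|split; [|split]]].
- destruct (bounds 1 ltac:(lra)) as [n0 H0].
  apply (eventually_bounded _ n0
    (Rabs (1 / PI * (c + lambda)) + Rabs (1 / PI * c) + 1)).
  intros n Hn; specialize (H0 n Hn); unfold Rabs; repeat destruct Rcase_abs; lra.
- intros [l Hl].
  assert (B3 : binary_exponents 3 [1; 0]%nat).
  { split; [|reflexivity]; repeat constructor. }
  assert (LP3 := LP _ (Theta_weights 3 [1; 0]%nat ltac:(lia) B3)).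
  assert (E := eq_trans (limit_point_lim _ _ _ LP1 Hl) (eq_sym (limit_point_lim _ _ _ LP3 Hl))).
  injection E as E; apply Rmult_eq_reg_l in E; [|apply Rgt_not_eq, Rdiv_lt_0_compat; lra].
  unfold Lambda, weights in E; simpl in E.
  assert (N1 : ln (2 * 1 / (1 + 1 + 1)) < 0) by (rewrite <- ln_1; apply ln_increasing; lra).
  assert (N2 : ln (1 / (1 + 1 + 1)) < 0) by (rewrite <- ln_1; apply ln_increasing; lra).
  lra.
- apply is_LimSup_seq_unique; intros [eps He]; simpl; split.
  + intros N; destruct (limit_point_frequently _ _ LP1 eps He N) as [n [Hn Hu]].
    exists n; split; [exact Hn|lra].
  + destruct (bounds (eps / 2) ltac:(lra)) as [n0 H0]; exists n0; intros n Hn.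
    specialize (H0 n Hn); lra.
- apply is_LimInf_seq_unique; intros [eps He]; simpl; split.
  + intros N.
    assert (X : exists theta, Theta theta /\ Lambda theta < lambda + PI * (eps / 2)).
    { apply NNPP; intros H.
      assert (Y : Rbar_le (lambda + PI * (eps / 2)) lambda).
      { apply (proj2 lambda_glb); intros x [theta [HT ->]]; simpl.
        destruct (Rlt_dec (Lambda theta) (lambda + PI * (eps / 2))) as [L|L]; [|lra].
        exfalso; apply H; now exists theta. }
      simpl in Y; nra. }
    destruct X as [theta [HT HL]].
    destruct (limit_point_frequently _ _ (LP theta HT) (eps / 2) ltac:(lra) N) as [n [Hn Hu]].
    exists n; split; [exact Hn|].
    assert (1 / PI * (c + Lambda theta) < 1 / PI * (c + lambda) + eps / 2); [|lra].
    replace (1 / PI * (c + lambda) + eps / 2) with (1 / PI * (c + (lambda + PI * (eps / 2))))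
      by (field; lra).
    apply Rmult_lt_compat_l; [|lra]; unfold Rdiv; lra.
  + destruct (bounds (eps / 2) ltac:(lra)) as [n0 H0]; exists n0; intros n Hn.
    specialize (H0 n Hn); lra.
- exact LP.
Qed.
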